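(* Let $A^E, A^I, b^E, b^I$ be problem data as in the context, with optimal solution $x^*$ of $\max_{x\in\mathcal C(0)}G(x)$, sum bounds $s_1,s_2$, $s^*=\sum_i x^*_i$, $\chi^*=x^*/s^*$ and $G^*=G(x^* )$. Assume that $x^*_i>1$ for all $i$. Then for any $\delta,\eta>0$, $$\frac{\#\nu^*}{\#\mathcal B_{n_1:n_2}(\delta,\eta)} \;>\; \frac{(m+1)\,e^{-m/12}\,\Gamma(m/2)}{2\pi^{m/2}}\;\frac{C_2(x^* )\,C_4(x^* )}{C_3(s_1,s_2)}\;e^{\eta G^*},$$ where $$C_2(x^* )=\sqrt{s^*}\prod_{1\le i\le m}\frac{\chi^*_i}{\sqrt{x^*_i+1}},\qquad C_4(x^* )=\exp\Bigl(-\frac12\Bigl(\sum_{1\le i\le m}\frac1{x^*_i-1}-\frac{m}{s^*/m-1}\Bigr)\Bigr),$$ $$C_3(s_1,s_2)=\bigl(\sqrt m+\sqrt{s_2+2}\bigr)^{m+1}-\bigl(\sqrt m+\sqrt{s_1}\bigr)^{m+1}.$$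
   Context: Let $m\ge 2$. Vector (in)equalities and $|\cdot|$ of a vector are element-wise; $0\ln 0=0$. Data: real matrices $A^E,A^I$ with $m$ columns and real vectors $b^E,b^I$ (equality and inequality constraints). $\mathcal C(0)=\{x\in\mathbb R^m: A^Ex=b^E,\ A^Ix\le b^I,\ x\ge 0\}$ is assumed non-empty and bounded. The generalized entropy of $x\ge0$ is $G(x)=-\sum_i x_i\ln x_i+(\sum_i x_i)\ln(\sum_i x_i)$. $x^*$ is the maximizer of $G$ over $\mathcal C(0)$; $s_1=\min_{x\in\mathcal C(0)}\sum_i x_i$, $s_2=\max_{x\in\mathcal C(0)}\sum_i x_i$; $n_1=\lceil s_1\rceil$, $n_2=\lceil s_2\rceil$, $n^*=\lceil s^*\rceil$. Tolerances: $\beta^E,\beta^I$ are $b^E,b^I$ with any zero elements replaced by fixed small positive constants, and for $\delta\ge0$, $\mathcal C(\delta)=\{x\in\mathbb R^m: b^E-\delta|\beta^E|\le A^Ex\le b^E+\delta|\beta^E|,\ A^Ix\le b^I+\delta|\beta^I|\}$. Count vectors are vectors $\nu\in\mathbb N^m$ (zeros allowed). $\#\nu=\binom{\nu_1+\cdots+\nu_m}{\nu_1,\ldots,\nu_m}$ (multinomial coefficient) is the number of realizations of $\nu$; for a set of count vectors, $\#$ is the sum of $\#\nu$ over its elements. A ratio with denominator $0$ is read as $+\infty$. $\mathcal B_{n_1:n_2}(\delta,\eta)$ is the set of count vectors $\nu\in\mathcal C(\delta)$ with $n_1\le\sum_i\nu_i\le n_2$ and $G(\nu)<(1-\eta)G^*$.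 Optimal count vector $\nu^*$: let $\tilde\nu=[n^*\chi^*]$ be $n^*\chi^*$ with each element rounded to a nearest integer, and $d=\sum_i\tilde\nu_i-n^*$. If $d=0$, $\nu^*=\tilde\nu$; if $d<0$, $\nu^*$ is obtained by adding 1 to $|d|$ elements of $\tilde\nu$ that were rounded down; if $d>0$, by subtracting 1 from $d$ elements that were rounded up. (Any such choice is allowed.) *)

(* Defs.v *)
From mathcomp Require Import all_boot all_order all_algebra.
From mathcomp Require Import all_classical all_reals all_analysis.

Set Implicit Arguments.
Unset Strict Implicit.
Unset Printing Implicit Defensive.

Import Order.TTheory GRing.Theory Num.Theory.
Import numFieldNormedType.Exports.

Local Open Scope classical_set_scope.
Local Open Scope ring_scope.

(* Euler's integral; it diverges for a <= 0, where the value is junk. *)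
Definition GammaR (R : realType) (a : R) : R :=
  \int[@lebesgue_measure R]_(t in `]0, +oo[) (t `^ (a - 1) * expR (- t)).

Definition is_min (R : realType) (S : set R) (v : R) : Prop := S v /\ lbound S v.
Definition is_max (R : realType) (S : set R) (v : R) : Prop := S v /\ ubound S v.

(* elementwise order and absolute value *)
Definition vle (R : realType) (k : nat) (u v : 'cV[R]_k) : Prop :=
  forall i, u i 0 <= v i 0.
Definition vabs (R : realType) (k : nat) (u : 'cV[R]_k) : 'cV[R]_k :=
  map_mx Num.norm u.

Definition vsum (R : realType) (m : nat) (x : 'cV[R]_m) : R := \sum_i x i 0.

(* ln 0 = 0, so that 0 * ln 0 = 0 as required. *)
Definition entropy (R : realType) (m : nat) (x : 'cV[R]_m) : R :=
  - (\sum_i x i 0 * ln (x i 0)) + vsum x * ln (vsum x).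

(* C(0): unlike [tolerant] at delta = 0, it requires x >= 0. *)
Definition feasible (R : realType) (m p q : nat)
    (AE : 'M[R]_(p, m)) (AI : 'M[R]_(q, m)) (bE : 'cV[R]_p) (bI : 'cV[R]_q) :
    set 'cV[R]_m :=
  [set x | [/\ AE *m x = bE, vle (AI *m x) bI & vle 0 x]].

(* beta is b with its zero elements replaced by positive constants. *)
Definition zeros_replaced (R : realType) (k : nat) (b beta : 'cV[R]_k) : Prop :=
  forall i, (b i 0 = 0 -> 0 < beta i 0) /\ (b i 0 <> 0 -> beta i 0 = b i 0).

(* C(delta) *)
Definition tolerant (R : realType) (m p q : nat)
    (AE : 'M[R]_(p, m)) (AI : 'M[R]_(q, m)) (bE : 'cV[R]_p) (bI : 'cV[R]_q)
    (betaE : 'cV[R]_p) (betaI : 'cV[R]_q) (delta : R) : set 'cV[R]_m :=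
  [set x | [/\ vle (bE - delta *: vabs betaE) (AE *m x),
               vle (AE *m x) (bE + delta *: vabs betaE) &
               vle (AI *m x) (bI + delta *: vabs betaI)]].

(* Count vectors are the elements of 'cV[nat]_m. *)
Definition realv (R : realType) (m : nat) (nu : 'cV[nat]_m) : 'cV[R]_m :=
  map_mx (fun k : nat => k%:R) nu.

Definition csum (m : nat) (nu : 'cV[nat]_m) : nat := (\sum_i nu i ord0)%N.

(* multinomial coefficient; the division is exact *)
Definition nb_real (m : nat) (nu : 'cV[nat]_m) : nat :=
  ((csum nu)`! %/ \prod_i (nu i ord0)`!)%N.

(* valued in \bar R, where 0^-1 = +oo: a ratio with denominator 0 is +oo *)
Definition nb_real_set (R : realType) (m : nat) (B : set 'cV[nat]_m) : \bar R :=
  \esum_(nu in B) (nb_real nu)%:R%:E.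

(* B_{n1:n2}(delta, eta), with C for C(delta) and Gs for G^* *)
Definition low_entropy (R : realType) (m : nat) (C : set 'cV[R]_m)
    (n1 n2 : int) (Gs eta : R) : set 'cV[nat]_m :=
  [set nu | [/\ C (realv R nu), n1 <= (csum nu)%:Z <= n2 &
               entropy (realv R nu) < (1 - eta) * Gs]].

(* Coordinates whose entry of y is an integer are not rounded in either
   direction, hence the strict inequalities between t and y. *)
Definition is_rounding (R : realType) (m : nat) (y : 'cV[R]_m)
    (t : 'cV[int]_m) : Prop :=
  forall i, `|y i 0 - (t i 0)%:~R| <= 2^-1.

Definition is_optimal_count (R : realType) (m : nat) (n : int) (chi : 'cV[R]_m)
    (nu : 'cV[nat]_m) : Prop :=
  let y := n%:~R *: chi in
  exists2 t : 'cV[int]_m, is_rounding y t &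
    let d : int := (\sum_i t i 0) - n in
    [/\ d = 0 -> forall i, (nu i ord0)%:Z = t i 0,
        d < 0 -> exists D : {set 'I_m},
          [/\ #|D|%:Z = - d,
              forall i, i \in D -> (t i 0)%:~R < y i 0 &
              forall i, (nu i ord0)%:Z = t i 0 + (i \in D)%:Z] &
        0 < d -> exists D : {set 'I_m},
          [/\ #|D|%:Z = d,
              forall i, i \in D -> y i 0 < (t i 0)%:~R &
              forall i, (nu i ord0)%:Z = t i 0 - (i \in D)%:Z]].

Definition C2 (R : realType) (m : nat) (x : 'cV[R]_m) : R :=
  Num.sqrt (vsum x) *
  \prod_i ((x i 0 / vsum x) / Num.sqrt (x i 0 + 1)).

Definition C3 (R : realType) (m : nat) (s1 s2 : R) : R :=
  (Num.sqrt m%:R + Num.sqrt (s2 + 2)) ^+ m.+1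
  - (Num.sqrt m%:R + Num.sqrt s1) ^+ m.+1.

Definition C4 (R : realType) (m : nat) (x : 'cV[R]_m) : R :=
  expR (- (2^-1 * (\sum_i (x i 0 - 1)^-1
                   - m%:R / (vsum x / m%:R - 1)))).

(* Main.v *)
Require Import Defs.
From mathcomp Require Import all_boot all_order all_algebra.
From mathcomp Require Import all_classical all_reals all_analysis.
From mathcomp Require Import measurable_realfun.
From mathcomp Require Import ring lra zify.

(* Since #nu = e^(G nu) (n! / n^n) \prod_i nu_i^(nu_i) / nu_i! for a count vector
   nu of sum n, the denominator is at most e^((1 - eta) G^* ) times the sum over
   n1 <= n <= n2 of the Shtarkov sums
     S_m(n) = (n! / n^n) [X^n] A^m,   A = \sum_k (k^k / k!) X^k.
   As A = 1 / (1 - T) for the tree function T, one has X A' = A^3 - A^2, hence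
   S_(m+2) = S_(m+1) + (n / m) S_m, and induction on m gives
     S_m(n) <= K_m (sqrt m + sqrt n)^(m-1),
     K_m = sqrt(2 pi) 2^(-m/2) / Gamma(m/2).
   The right-hand side is at most 2 K_m / (m + 1) times the increment between n and
   n + 1 of (sqrt m + sqrt x)^(m+1), so the sum over n telescopes to C3.
   For the numerator, Stirling's formula (with the constant obtained from the
   half-integer values of Gamma) reduces the claim to
   G(nu^* ) >= G(x^* - 1) >= G^* + \sum_i ln chi_i + ln C4, where the first
   inequality is monotonicity of G and the second one is Jensen's inequality for
   w ln (1 + 1/w) + 1/(2w) at w = x_i - 1, together with
   \prod_i nu_i <= \prod_i (x_i + 1). *)

Import Order.TTheory GRing.Theory Num.Theory.
Import numFieldNormedType.Exports.
Local Open Scope classical_set_scope.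
Local Open Scope ring_scope.

(** * Half-integer values of the Gamma function *)

Section gauss_moments.
Context {R : realType}.
Notation mu := (@lebesgue_measure R).

(* The absolute value makes the integrand nonnegative on the whole line, as required by
   [ge0_cvgn_integral]. *)
Definition gauss_moment (k : nat) (x : R) : R := `|x| ^+ k * expR (- x ^+ 2).

Lemma gauss_moment_ge0 k x : 0 <= gauss_moment k x.
Proof. by rewrite mulr_ge0 ?exprn_ge0 ?expR_ge0. Qed.

Lemma measurable_gauss_moment k : measurable_fun setT (gauss_moment k).
Proof.
apply: measurable_funM; last exact: measurable_gauss_fun.
by apply: measurable_funX; exact: normr_measurable.
Qed.

Lemma cvg_gauss_moment k :
  (\int[mu]_(x in `[0%R, n%:R]) (gauss_moment k x)%:E @[n --> \oo] -->
  \int[mu]_(x in `[0%R, +oo[) (gauss_moment k x)%:E)%E.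
Proof.
exact: ge0_cvgn_integral (gauss_moment_ge0 k) (measurable_gauss_moment k).
Qed.

Lemma integrable_gauss_momentS k (a b : R) :
  mu.-integrable `[a, b] (EFin \o gauss_moment k).
Proof.
apply: continuous_compact_integrable; first exact: segment_compact.
apply: continuous_subspaceT => x; apply: cvgM.
  apply: (@continuous_comp _ _ _ (fun x : R => `|x|) (fun z => z ^+ k)).
    exact: norm_continuous.
  exact: exprn_continuous.
exact: continuous_gauss_fun.
Qed.

(** Integrates x^(k+1) against x exp(-x^2), the derivative of -exp(-x^2) / 2; on a bounded interval
    the boundary term at the right end remains. *)
Lemma gauss_moment_by_parts k n :
  \int[mu]_(x in `[0, n.+1%:R]) gauss_moment k.+2 x =
  k.+1%:R / 2 * \int[mu]_(x in `[0, n.+1%:R]) gauss_moment k x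
  - n.+1%:R ^+ k.+1 * expR (- n.+1%:R ^+ 2) / 2.
Proof.
rewrite -RintegralZl//; last exact: integrable_gauss_momentS.
pose F (x : R) := x ^+ k.+1; pose G (x : R) := - expR (- x ^+ 2) / 2.
pose f (x : R) := k.+1%:R * x ^+ k; pose g (x : R) := x * expR (- x ^+ 2).
have dF x : is_derive x (1:R) F (f x).
  rewrite /F (_ : (fun x => x ^+ k.+1) = (id : R -> R) ^+ k.+1); last first.
    by apply/funext => y; rewrite exprfctE.
  apply: is_derive_eq; rewrite /f /GRing.scale/= mulr1//.
have dG x : is_derive x (1:R) G (g x).
  rewrite /G /g; apply: is_derive_eq.
  by rewrite /GRing.scale/=; lra.
have cF : continuous F.
  by move=> x; apply: differentiable_continuous; apply/derivable1_diffP; case: (dF x).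
have cG : continuous G.
  by move=> x; apply: differentiable_continuous; apply/derivable1_diffP; case: (dG x).
have cf : continuous f.
  move=> x; apply: cvgM; first exact: cvg_cst.
  exact: exprn_continuous.
have cg : continuous g.
  move=> x; apply: cvgM; first exact: cvg_id.
  exact: continuous_gauss_fun.
have n0 : (0 : R) < n.+1%:R by rewrite ltr0n.
have dLR (H h : R -> R) : continuous H -> (forall x, is_derive x (1:R) H (h x)) ->
    derivable_oo_LRcontinuous H 0 n.+1%:R.
  move=> cH dH; split; first by move=> x _; case: (dH x).
    by apply: cvg_at_right_filter; exact: cH.
  by apply: cvg_at_left_filter; exact: cH.
have /= P := @Rintegration_by_parts R F G f g 0 n.+1%:R n0
  (continuous_subspaceT cf) (dLR _ _ cF dF) _ (continuous_subspaceT cg)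
  (dLR _ _ cG dG) _.
transitivity (\int[mu]_(x in `[0, n.+1%:R]) (F x * g x)).
  apply: eq_Rintegral => x; rewrite inE/= in_itv/= => /andP[x0 _].
  by rewrite /gauss_moment ger0_norm// /F /g mulrA -exprSr.
rewrite P; last 2 first.
- by move=> x _; rewrite derive1E; case: (dF x).
- by move=> x _; rewrite derive1E; case: (dG x).
rewrite /(F 0) expr0n/= mul0r subr0 addrC; congr (_ + _); last first.
  by rewrite /F /G; ring.
rewrite -mulN1r -RintegralZl//; last first.
  apply: continuous_compact_integrable; first exact: segment_compact.
  apply: continuous_subspaceT => x; apply: cvgM; [exact: cf|exact: cG].
apply: eq_Rintegral => x; rewrite inE/= in_itv/= => /andP[x0 _].
by rewrite /gauss_moment /f /G ger0_norm//; field.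
Qed.

(** The exponential series gives exp(y) >= y^(k+1) / (k+1)!, and y = n^2 bounds the sequence by
    (k+1)! / n. *)
Lemma cvg_expn_gauss k : (n%:R ^+ k * expR (- n%:R ^+ 2) : R) @[n --> \oo] --> (0 : R).
Proof.
suff H n : n.+1%:R ^+ k * expR (- n.+1%:R ^+ 2) <= k.+1`!%:R * (n.+1%:R : R)^-1.
  rewrite -cvg_shiftS.
  apply: (@squeeze_cvgr _ _ _ _ (cst 0) (fun n => k.+1`!%:R * (n.+1%:R : R)^-1)).
  - by near=> n; rewrite H andbT mulr_ge0 ?exprn_ge0 ?expR_ge0.
  - exact: cvg_cst.
  - rewrite -[0](mulr0 (k.+1`!%:R : R)); apply: cvgM; first exact: cvg_cst.
    exact: cvg_harmonic.
have n0 : (0 : R) < n.+1%:R by rewrite ltr0n.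
rewrite expRN ler_pdivrMr ?expR_gt0// mulrAC ler_pdivlMr// -exprSr.
have := @expR_ge1Dxn R (n.+1%:R ^+ 2) k (sqr_ge0 _).
move/(le_trans (ler_wpDl ler01 (lexx _))).
rewrite ler_pdivrMr ?ltr0n ?fact_gt0// mulrC; apply: le_trans.
by rewrite lerXn2r ?nnegrE// expr2 ler_peMl// ler1n.
Unshelve. all: end_near. Qed.

(** The boundary term of [gauss_moment_by_parts] vanishes in the limit. A real v makes the limit
    finite, so that it can be taken in R. *)
Lemma gauss_moment_rec k (v : R) :
  (\int[mu]_(x in `[0%R, +oo[) (gauss_moment k x)%:E = v%:E)%E ->
  (\int[mu]_(x in `[0%R, +oo[) (gauss_moment k.+2 x)%:E = (k.+1%:R / 2 * v)%:E)%E.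
Proof.
move=> kv.
have RE j n : (\int[mu]_(x in `[0%R, n%:R]) (gauss_moment j x)%:E =
     (\int[mu]_(x in `[0%R, n%:R]) gauss_moment j x)%:E)%E.
  by rewrite fineK// integrable_fin_num//; exact: integrable_gauss_momentS.
have := @cvg_gauss_moment k; rewrite kv.
under eq_fun do rewrite RE.
move=> /fine_cvg /= cv.
have := @cvg_gauss_moment k.+2.
move/(cvg_lim (@ereal_hausdorff R)) => <-.
apply/cvg_lim => //.
under eq_fun do rewrite RE.
apply: cvg_EFin; first by near=> n.
rewrite -cvg_shiftS.
under eq_fun do rewrite /= gauss_moment_by_parts.
rewrite -[k.+1%:R / 2 * v]subr0; apply: cvgB.
  by apply: cvgM; [exact: cvg_cst|rewrite (cvg_shiftS (fun n => fine _))].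
rewrite -[0](mul0r (2^-1 : R)); apply: cvgM; last exact: cvg_cst.
rewrite (cvg_shiftS (fun n => n%:R ^+ k.+1 * expR (- n%:R ^+ 2))).
exact: cvg_expn_gauss.
Unshelve. all: end_near. Qed.

Lemma gauss_moment0 :
  (\int[mu]_(x in `[0%R, +oo[) (gauss_moment 0 x)%:E = (Num.sqrt pi / 2)%:E)%E.
Proof.
by rewrite -integral0y_gauss; apply: eq_integral => x _; rewrite /gauss_moment mul1r.
Qed.

Lemma gauss_moment1 :
  (\int[mu]_(x in `[0%R, +oo[) (gauss_moment 1 x)%:E = (2^-1)%:E)%E.
Proof.
pose G (x : R) := - expR (- x ^+ 2) / 2; pose g (x : R) := x * expR (- x ^+ 2).
have dG x : is_derive x (1:R) G (g x).
  rewrite /G /g; apply: is_derive_eq.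
  by rewrite /GRing.scale/=; lra.
have cG : continuous G.
  by move=> x; apply: differentiable_continuous; apply/derivable1_diffP; case: (dG x).
have cg : continuous g.
  move=> x; apply: cvgM; first exact: cvg_id.
  exact: continuous_gauss_fun.
rewrite (_ : 2^-1 = 0 - G 0); last by rewrite /G expr0n/= oppr0 expR0; field.
rewrite EFinB -(@ge0_continuous_FTC2y R g G 0 0).
- by apply: eq_integral => x; rewrite inE/= in_itv/= andbT => x0; rewrite /gauss_moment expr1 ger0_norm.
- by move=> x x0; rewrite mulr_ge0 ?expR_ge0.
- exact: continuous_subspaceT.
- rewrite -[0](mul0r (2^-1 : R)); apply: cvgM; last exact: cvg_cst.
  by rewrite -oppr0; apply: cvgN; exact: cvg_gauss_fun.
- by move=> x _; case: (dG x).
- by apply: cvg_at_right_filter; exact: cG.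
- by move=> x _; rewrite derive1E; case: (dG x).
Qed.

End gauss_moments.

Section gamma.
Context {R : realType}.
Notation mu := (@lebesgue_measure R).

Lemma continuous_gamma_fun (a b : R) : 0 <= a -> 0 < b ->
  {within `[0, b], continuous (fun t => t `^ a * expR (- t))}.
Proof.
move=> a0 b0; have cp t : 0 < t -> {for t, continuous (fun t => t `^ a * expR (- t))}.
  move=> t0; apply: cvgM.
    have /derivable1_diffP : derivable (@powR R ^~ a) t 1.
      by apply: derivable_powR; rewrite in_itv/= t0.
    exact: differentiable_continuous.
  apply: (@continuous_comp _ _ _ -%R expR); first exact: oppr_continuous.
  exact: continuous_expR.
apply/continuous_within_itvP => //; split.
- by move=> t; rewrite in_itv/= => /andP[t0 _]; exact: cp.
- apply: cvgM; last first.
    apply: cvg_at_right_filter.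
    apply: (@continuous_comp _ _ _ -%R expR); first exact: oppr_continuous.
    exact: continuous_expR.
  (* Continuity at 0 for a = 0 rests on the convention 0^0 = 1 for real powers. *)
  move: a0; rewrite le_eqVlt => /predU1P[<-|a0].
    by under eq_fun do rewrite powRr0; rewrite powRr0; exact: cvg_cst.
  by rewrite powR0 ?gt_eqF//; exact: powR_cvg0.
- by apply: cvg_at_left_filter; exact: cp.
Qed.

(** Substitution t = x^2. The exponent k/2 is nonnegative, so the integrand is continuous up to 0;
    among the positive half-integers this leaves out only Gamma(1/2), and m >= 2. *)
Lemma integral_gamma_half k n :
  (\int[mu]_(t in `[0%R, (n.+1 ^ 2)%N%:R]) (t `^ (k.+2%:R / 2 - 1) * expR (- t))%:E =
   \int[mu]_(x in `[0%R, n.+1%:R]) (2 * gauss_moment k.+1 x)%:E)%E.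
Proof.
pose F (x : R) := x ^+ 2.
have dF x : is_derive x (1:R) F (2 * x).
  rewrite /F; apply: is_derive_eq; rewrite /GRing.scale/=; lra.
have F1E : derive1 F = (fun x => 2 * x).
  by apply/funext => x; rewrite derive1E; case: (dF x).
have cF : continuous F.
  by move=> x; apply: differentiable_continuous; apply/derivable1_diffP; case: (dF x).
have cF' : continuous (fun x : R => 2 * x).
  by move=> x; apply: cvgM; [exact: cvg_cst|exact: cvg_id].
have n0 : (0 : R) < n.+1%:R by rewrite ltr0n.
have := @integration_by_substitution_increasing R F
  (fun t => t `^ (k.+2%:R / 2 - 1) * expR (- t)) 0 n.+1%:R (ltW n0).
have F0 : F 0 = 0 by rewrite /F expr0n.
have Fn : F n.+1%:R = (n.+1 ^ 2)%N%:R by rewrite natrX.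
rewrite F1E F0 Fn => ->.
- apply: eq_integral => x; rewrite inE/= in_itv/= => /andP[x0 _].
  congr EFin; rewrite /= /gauss_moment ger0_norm// /F.
  change ((x ^+ 2) `^ (k.+2%:R / 2 - 1) * expR (- x ^+ 2) * (2 * x)
    = 2 * (x ^+ k.+1 * expR (- x ^+ 2))).
  move: x0; rewrite le_eqVlt => /predU1P[<-|x0].
by rewrite !mulr0 expr0n/= mul0r mulr0.
  rewrite -powR_mulrn ?ltW// -powRrM (_ : 2%:R * _ = k%:R); last by rewrite -natr1 -natr1; field.
  by rewrite powR_mulrn ?ltW// exprS; ring.
- move=> x y; rewrite !in_itv/= => /andP[x0 _] /andP[y0 _] xy.
  by rewrite /F ltrXn2r ?nnegrE.
- by move=> x _; exact: cF'.
- apply/cvg_ex; exists (2 * 0); apply: cvg_at_right_filter; exact: cF'.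
- apply/cvg_ex; exists (2 * n.+1%:R); apply: cvg_at_left_filter; exact: cF'.
- split; first by move=> x _; case: (dF x).
    by apply: cvg_at_right_filter; exact: cF.
  by apply: cvg_at_left_filter; exact: cF.
- apply: continuous_gamma_fun; last by rewrite ltr0n expn_gt0.
  by rewrite subr_ge0 ler_pdivlMr// mul1r ler_nat.
Qed.

Lemma GammaR_half k :
  (\int[mu]_(t in `]0%R, +oo[) (t `^ (k.+2%:R / 2 - 1) * expR (- t))%:E =
   2%:E * \int[mu]_(x in `[0%R, +oo[) (gauss_moment k.+1 x)%:E)%E.
Proof.
set a := _ - 1.
have g0 (t : R) : 0 <= t `^ a * expR (- t) by rewrite mulr_ge0 ?powR_ge0 ?expR_ge0.
have mg : measurable_fun [set: R] (fun t : R => t `^ a * expR (- t)).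
  apply: measurable_funM; first exact: measurable_powR.
  exact: measurableT_comp.
rewrite integral_itv_obnd_cbnd; last by apply/measurable_EFinP; exact: measurable_funTS.
rewrite -ge0_integralZl//; last 2 first.
- by apply/measurable_EFinP; apply: measurable_funTS; exact: measurable_gauss_moment.
- by move=> x _; rewrite lee_fin gauss_moment_ge0.
have g2 (x : R) : 0 <= 2 * gauss_moment k.+1 x by rewrite mulr_ge0 ?gauss_moment_ge0.
have m2 : measurable_fun [set: R] (fun x : R => 2 * gauss_moment k.+1 x).
  by apply: measurable_funM => //; exact: measurable_gauss_moment.
rewrite -(cvg_lim (@ereal_hausdorff R) (ge0_cvgn_integral (mu := mu) g2 m2)).
(* The substitution only reaches the endpoints (n+1)^2, which is enough for the limit. *)
have sq : (n.+1 ^ 2)%N @[n --> \oo] --> \oo.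
  apply/cvgnyPge => A; near=> n.
  have : (A <= n)%N by near: n; exact: nbhs_infty_ge.
  by move=> An; rewrite (leq_trans An)// expnS expn1; nia.
apply/esym/cvg_lim; first exact: ereal_hausdorff.
rewrite -cvg_shiftS.
under eq_fun do rewrite -integral_gamma_half.
exact: (cvg_comp _ _ sq (ge0_cvgn_integral (mu := mu) g0 mg)).
Unshelve. all: end_near. Qed.

(* x <= (l x^2 + 1/l) / 2, multiplied by x^k exp(-x^2). *)
Lemma gauss_moment_AMGM k (l : R) : 0 < l ->
  (\int[mu]_(x in `[0%R, +oo[) (gauss_moment k.+1 x)%:E <=
   (l / 2)%:E * \int[mu]_(x in `[0%R, +oo[) (gauss_moment k.+2 x)%:E +
   (l^-1 / 2)%:E * \int[mu]_(x in `[0%R, +oo[) (gauss_moment k x)%:E)%E.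
Proof.
move=> l0; have l1 : 0 <= l / 2 by rewrite divr_ge0 ?ltW.
have l2 : 0 <= l^-1 / 2 by rewrite divr_ge0 ?invr_ge0 ?ltW.
have mE j : measurable_fun (`[0%R, +oo[%classic : set R) (fun x : R => (gauss_moment j x)%:E).
  by apply/measurable_EFinP; apply: measurable_funTS; exact: measurable_gauss_moment.
have mM (c : R) j : measurable_fun (`[0%R, +oo[%classic : set R) (fun x : R => (c%:E * (gauss_moment j x)%:E)%E).
  by apply: emeasurable_funM => //; exact: measurable_cst.
have ge0 (c : R) j (x : R) : 0 <= c -> (0 <= c%:E * (gauss_moment j x)%:E)%E.
  by move=> c0; rewrite mule_ge0 ?lee_fin ?gauss_moment_ge0.
rewrite -!ge0_integralZl//; try by [exact: mE | move=> x _; rewrite lee_fin gauss_moment_ge0].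
rewrite -ge0_integralD//; try by [exact: mM | move=> x _; exact: ge0].
apply: ge0_le_integral => //.
- by move=> x _; rewrite lee_fin gauss_moment_ge0.
- exact: mE.
- by apply: emeasurable_funD; exact: mM.
move=> x _; rewrite -!EFinM -EFinD lee_fin /gauss_moment !(exprS `|x| _).
have -> : l / 2 * (`|x| * (`|x| * `|x| ^+ k) * expR (- x ^+ 2)) +
   l^-1 / 2 * (`|x| ^+ k * expR (- x ^+ 2)) =
   (l / 2 * `|x| ^+ 2 + l^-1 / 2) * (`|x| ^+ k * expR (- x ^+ 2)) by rewrite expr2; ring.
rewrite -mulrA ler_wpM2r ?mulr_ge0 ?exprn_ge0 ?expR_ge0//.
rewrite -subr_ge0 (_ : _ - _ = l^-1 / 2 * (l * `|x| - 1) ^+ 2); last by field; rewrite gt_eqF.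
by rewrite mulr_ge0// sqr_ge0.
Qed.

(* Gamma((k + 1) / 2) / 2, the integral of x^k exp(-x^2) over the half-line. *)
Fixpoint gauss_val (k : nat) : R :=
  match k with
  | 0 => Num.sqrt pi / 2
  | 1 => 2^-1
  | j.+2 => j.+1%:R / 2 * gauss_val j
  end.

Lemma gauss_valS k : gauss_val k.+2 = k.+1%:R / 2 * gauss_val k.
Proof. by []. Qed.

Lemma gauss_valE k :
  (\int[mu]_(x in `[0%R, +oo[) (gauss_moment k x)%:E = (gauss_val k)%:E)%E.
Proof.
have [//] : (\int[mu]_(x in `[0%R, +oo[) (gauss_moment k x)%:E = (gauss_val k)%:E)%E
  /\ (\int[mu]_(x in `[0%R, +oo[) (gauss_moment k.+1 x)%:E = (gauss_val k.+1)%:E)%E.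
elim: k => [|k [IH1 IH2]]; first by split; [exact: gauss_moment0|exact: gauss_moment1].
by split => //; exact: gauss_moment_rec.
Qed.

Lemma GammaR_gauss k : GammaR (k.+2%:R / 2) = 2 * gauss_val k.+1.
Proof. by rewrite /GammaR /Rintegral GammaR_half gauss_valE. Qed.

Lemma gauss_val_gt0 k : 0 < gauss_val k.
Proof.
have [//] : 0 < gauss_val k /\ 0 < gauss_val k.+1.
elim: k => [|k [IH1 IH2]].
  by split => /=; rewrite ?invr_gt0// divr_gt0// sqrtr_gt0 pi_gt0.
by split => //=; rewrite mulr_gt0// divr_gt0.
Qed.

(** Cauchy-Schwarz for the moments, i.e. log-convexity of Gamma: l = s^-1 minimizes the right-hand
    side of [gauss_moment_AMGM], whose two terms then both equal s [gauss_val k] / 2. *)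
Lemma gauss_val_ratio k : gauss_val k.+1 ^+ 2 <= k.+1%:R / 2 * gauss_val k ^+ 2.
Proof.
set s := Num.sqrt (k.+1%:R / 2 : R).
have s0 : 0 < s by rewrite sqrtr_gt0 divr_gt0.
have si0 : 0 < s^-1 by rewrite invr_gt0.
have sE : s ^+ 2 = k.+1%:R / 2 by rewrite sqr_sqrtr// divr_ge0.
have := gauss_moment_AMGM k _ si0.
rewrite !gauss_valE -!EFinM -EFinD lee_fin invrK /= -sE.
rewrite (_ : _ + _ = s * gauss_val k); last by field; rewrite gt_eqF.
move=> H; rewrite -exprMn lerXn2r// nnegrE; first exact: ltW (gauss_val_gt0 k.+1).
by rewrite mulr_ge0 ?ltW// gauss_val_gt0.
Qed.

End gamma.

(** * Logarithm inequalities *)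

Section ln_bounds.
Context {R : realType}.
Implicit Types x u : R.

Lemma eq_ler x u : x = u -> x <= u. Proof. by move=> ->. Qed.

Lemma derive_ge0_ge0 (f df : R -> R) :
  (forall x, 0 <= x -> is_derive x (1 : R) f (df x)) ->
  (forall x, 0 <= x -> 0 <= df x) -> f 0 = 0 ->
  forall x, 0 <= x -> 0 <= f x.
Proof.
move=> dfE df0 f0 x; rewrite le_eqVlt => /predU1P[<-|x0]; first by rewrite f0.
have [|| z zx] := @MVT_segment R f df 0 x (ltW x0).
- by move=> y; rewrite in_itv/= => /andP[y0 _]; apply: dfE; rewrite ltW.
- apply: derivable_within_continuous => y; rewrite in_itv/= => /andP[y0 _].
  by case: (dfE y y0).
rewrite f0 !subr0 => ->; move: zx; rewrite in_itv/= => /andP[z0 _].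
by rewrite mulr_ge0 ?df0// ltW.
Qed.

(** One family for the three differences shown nonnegative below: after partial fractions each is
    affine, plus poles at -1 and -2, plus a logarithm. *)
Lemma is_derive_ln_rat (a b c d e x : R) : -1 < x ->
  is_derive x (1 : R) (fun y => a * y + b - c / (1 + y) - d / (2 + y) - e * ln (1 + y))
    (a + c / (1 + x) ^+ 2 + d / (2 + x) ^+ 2 - e / (1 + x)).
Proof.
move=> x1; have x10 : 0 < 1 + x by lra.
have x20 : 0 < 2 + x by lra.
have dc (r : R) : is_derive x (1 : R) (fun y => r + y) 1.
  rewrite -[X in is_derive _ _ _ X]add0r.
  exact: (@is_deriveD _ _ _ (cst r) id).
have dln : is_derive x (1 : R) (fun y => ln (1 + y)) (1 + x)^-1.
  rewrite -[X in is_derive _ _ _ X]mulr1.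
  apply: (is_derive1_comp (f := @ln R) (g := fun y => 1 + y)); by exact: is_derive1_ln.
have d1 : is_derive x (1 : R) (fun y => (1 + y)^-1) (- (1 + x) ^- 2).
  have -> : - (1 + x) ^- 2 = - (1 + x) ^- 2 *: (1 : R) by rewrite /GRing.scale/= mulr1.
  apply: (is_deriveV (f := fun y => 1 + y)); by rewrite gt_eqF.
have d2 : is_derive x (1 : R) (fun y => (2 + y)^-1) (- (2 + x) ^- 2).
  have -> : - (2 + x) ^- 2 = - (2 + x) ^- 2 *: (1 : R) by rewrite /GRing.scale/= mulr1.
  apply: (is_deriveV (f := fun y => 2 + y)); by rewrite gt_eqF.
apply: is_derive_eq; rewrite /GRing.scale/=.
ring.
Qed.

(** At x = 1/n the left-hand side is 1 / (n + 1/2), which is what makes [stirling_err] decrease. The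
    coefficients come from 2x / (2 + x) = 2 - 4 / (2 + x). *)
Lemma ln1D_ge x : 0 <= x -> 2 * x / (2 + x) <= ln (1 + x).
Proof.
move=> x0; rewrite -subr_ge0.
have := @derive_ge0_ge0 (fun y => 0 * y + (-2) - 0 / (1 + y) - (-4) / (2 + y) - (-1) * ln (1 + y)) _
  (fun y y0 => @is_derive_ln_rat 0 (-2) 0 (-4) (-1) y (lt_le_trans (ltrN10 R) y0)) _ _ x x0.
rewrite (_ : ln _ - _ = 0 * x + (-2) - 0 / (1 + x) - (-4) / (2 + x) - (-1) * ln (1 + x)); last first.
  by field; rewrite gt_eqF//; lra.
apply.
- move=> y y0; rewrite (_ : _ - _ = y ^+ 2 / ((1 + y) * (2 + y) ^+ 2)); last first.
    by field; rewrite !gt_eqF//; lra.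
  by rewrite divr_ge0 ?sqr_ge0// mulr_ge0 ?sqr_ge0//; lra.
- by rewrite !addr0 ln1; field.
Qed.

(** At x = 1/n the correction x^2 / (12 (1 + x)) is 1/(12 n) - 1/(12 (n+1)), the telescoping term of
    [stirling_err_incr]. *)
Lemma ln1D_le x : 0 <= x ->
  ln (1 + x) <= 2 * x / (2 + x) * (1 + x ^+ 2 / (12 * (1 + x))).
Proof.
move=> x0; rewrite -subr_ge0.
have := @derive_ge0_ge0 (fun y => 6^-1 * y + 3/2 - 6^-1 / (1 + y) - (8/3) / (2 + y) - 1 * ln (1 + y)) _
  (fun y y0 => @is_derive_ln_rat 6^-1 (3/2) 6^-1 (8/3) 1 y (lt_le_trans (ltrN10 R) y0)) _ _ x x0.
rewrite (_ : _ - ln _ = 6^-1 * x + 3/2 - 6^-1 / (1 + x) - (8/3) / (2 + x) - 1 * ln (1 + x)); last first.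
  by field; rewrite !gt_eqF//; lra.
apply.
- move=> y y0; rewrite (_ : _ - _ = y ^+ 4 / (6 * (1 + y) ^+ 2 * (2 + y) ^+ 2)); last first.
    by field; rewrite !gt_eqF//; lra.
  by apply: divr_ge0; rewrite ?mulr_ge0 ?exprn_ge0 ?addr_ge0.
- by rewrite !addr0 ln1; field.
Qed.

Lemma ln_le_sub_inv u : 1 <= u -> ln u <= (u - u^-1) / 2.
Proof.
move=> u1; have [x x0 ->] : exists2 x, 0 <= x & u = 1 + x.
  by exists (u - 1); lra.
rewrite -subr_ge0.
have := @derive_ge0_ge0 (fun y => 2^-1 * y + 2^-1 - 2^-1 / (1 + y) - 0 / (2 + y) - 1 * ln (1 + y)) _
  (fun y y0 => @is_derive_ln_rat 2^-1 2^-1 2^-1 0 1 y (lt_le_trans (ltrN10 R) y0)) _ _ x x0.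
rewrite (_ : _ - ln _ = 2^-1 * x + 2^-1 - 2^-1 / (1 + x) - 0 / (2 + x) - 1 * ln (1 + x)); last first.
  by field; rewrite !gt_eqF//; lra.
apply.
- move=> y y0; rewrite (_ : _ - _ = y ^+ 2 / (2 * (1 + y) ^+ 2)); last first.
    by field; rewrite !gt_eqF//; lra.
  by apply: divr_ge0; rewrite ?mulr_ge0 ?exprn_ge0 ?addr_ge0.
- by rewrite !addr0 ln1; field.
Qed.

Lemma ln_le_sub_div u : 0 < u -> u <= 1 -> ln u <= 2 * (u - 1) / (u + 1).
Proof.
move=> u0 u1; have ui : 0 <= u^-1 - 1 by rewrite subr_ge0 invf_ge1.
have := ln1D_ge _ ui; rewrite (addrC 1) subrK lnV// lerNr => /le_trans; apply.
by apply: eq_ler; field; rewrite !gt_eqF//; lra.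
Qed.

End ln_bounds.

(** * Stirling's formula *)

Section stirling.
Context {R : realType}.

Lemma gauss_val_odd n : gauss_val n.*2.+1 = n`!%:R / 2 :> R.
Proof.
elim: n => [|n IH]; first by rewrite /= mul1r.
rewrite doubleS gauss_valS IH factS natrM.
by rewrite -addnn -addn2 !natrD -[n.+1]addn1 natrD; field.
Qed.

Lemma gauss_val_even n :
  gauss_val n.*2 = Num.sqrt pi / 2 * (n.*2`!%:R / (4 ^+ n * n`!%:R)) :> R.
Proof.
elim: n => [|n IH]; first by rewrite /= expr0 mul1r divr1 mulr1.
have f0 : (n`!%:R : R) != 0 by rewrite pnatr_eq0 -lt0n fact_gt0.
rewrite doubleS gauss_valS IH !factS !natrM exprS -addnn -!natr1 natrD.
field.
by rewrite f0 expf_neq0 ?pnatr_eq0//= natr1 pnatr_eq0.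
Qed.

(** This is 4^n / C(2n, n), asymptotic to sqrt(pi n). *)
Definition wallis n : R := n`!%:R ^+ 2 * 4 ^+ n / n.*2`!%:R.

Lemma wallis_gt0 n : 0 < wallis n.
Proof. by rewrite divr_gt0 ?mulr_gt0 ?exprn_gt0 ?ltr0n ?fact_gt0. Qed.

Lemma wallis_ratio n : gauss_val n.*2.+1 / gauss_val n.*2 = wallis n / Num.sqrt pi.
Proof.
rewrite gauss_val_odd gauss_val_even /wallis; field.
by rewrite !pnatr_eq0 -!lt0n !fact_gt0 expf_neq0 ?pnatr_eq0// gt_eqF// sqrtr_gt0 pi_gt0.
Qed.

(** [gauss_val_ratio] at the even index 2n bounds the quotient of [wallis_ratio] from above; an odd
    index bounds it from below in [wallis_ge]. *)
Lemma wallis_le n : wallis n ^+ 2 <= pi * (n%:R + 2^-1).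
Proof.
have g0 := gauss_val_gt0 (R := R) n.*2.
have : (gauss_val n.*2.+1 / gauss_val n.*2) ^+ 2 <= n.*2.+1%:R / 2 :> R.
  by rewrite exprMn exprVn ler_pdivrMr ?exprn_gt0// gauss_val_ratio.
rewrite wallis_ratio exprMn exprVn sqr_sqrtr ?pi_ge0// ler_pdivrMr ?pi_gt0// mulrC.
by move/le_trans; apply; rewrite -addnn -natr1 natrD; apply: eq_ler; field.
Qed.

Lemma wallis_ge n : pi * n%:R <= wallis n ^+ 2.
Proof.
case: n => [|n]; first by rewrite mulr0 sqr_ge0.
have g0 := gauss_val_gt0 (R := R) n.+1.*2.
have n0 : (0 : R) < n.+1%:R by [].
have H : gauss_val n.+1.*2 ^+ 2 <= n.+1%:R * (gauss_val n.+1.*2.+1 / n.+1%:R) ^+ 2 :> R.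
  have -> : gauss_val n.+1.*2.+1 / n.+1%:R = gauss_val n.*2.+1 :> R.
    rewrite !gauss_val_odd factS natrM; field.
    by rewrite addrC natr1 pnatr_eq0.
  have := gauss_val_ratio (R := R) n.*2.+1; rewrite doubleS => /le_trans; apply.
  by rewrite -addnn -!natr1 natrD; apply: eq_ler; field.
have : n.+1%:R <= (gauss_val n.+1.*2.+1 / gauss_val n.+1.*2) ^+ 2 :> R.
  rewrite exprMn exprVn ler_pdivlMr ?exprn_gt0//.
  move: H; rewrite -(ler_pM2l n0) => /le_trans; apply.
  by apply: eq_ler; field; rewrite addrC natr1 pnatr_eq0.
by rewrite wallis_ratio exprMn exprVn sqr_sqrtr ?pi_ge0// ler_pdivlMr ?pi_gt0// mulrC.
Qed.

(* The logarithm of n! / (sqrt n * (n / e)^n). *)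
Definition stirling_err n : R := ln n`!%:R - (n%:R + 2^-1) * ln n%:R + n%:R.

Lemma stirling_errB n : (0 < n)%N ->
  stirling_err n - stirling_err n.+1 = (n%:R + 2^-1) * ln (1 + n%:R^-1) - 1.
Proof.
move=> n0; have n0r : (0 : R) < n%:R by rewrite ltr0n.
have -> : 1 + n%:R^-1 = n.+1%:R / n%:R :> R by rewrite -natr1; field; rewrite gt_eqF.
rewrite ln_div ?posrE// /stirling_err factS natrM lnM ?posrE ?ltr0n ?fact_gt0//.
by rewrite -natr1; ring.
Qed.

Lemma stirling_err_decr n : (0 < n)%N -> stirling_err n.+1 <= stirling_err n.
Proof.
move=> n0; have n0r : (0 : R) < n%:R by rewrite ltr0n.
rewrite -subr_ge0 stirling_errB// subr_ge0.
have /ln1D_ge : (0 : R) <= n%:R^-1 by rewrite invr_ge0.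
have h0 : (0 : R) < n%:R + 2^-1 by lra.
move=> /(ler_wpM2l (ltW h0)); apply: le_trans; apply: eq_ler; field; rewrite !gt_eqF//; lra.
Qed.

Lemma stirling_err_incr n : (0 < n)%N ->
  stirling_err n - (12 * n%:R)^-1 <= stirling_err n.+1 - (12 * n.+1%:R)^-1.
Proof.
move=> n0; have n0r : (0 : R) < n%:R by rewrite ltr0n.
suff : stirling_err n - stirling_err n.+1 <= (12 * n%:R)^-1 - (12 * n.+1%:R)^-1.
  by set a := (12 * n%:R)^-1; set b := (12 * n.+1%:R)^-1; lra.
rewrite stirling_errB//.
have /ln1D_le : (0 : R) <= n%:R^-1 by rewrite invr_ge0.
have h0 : (0 : R) < n%:R + 2^-1 by lra.
move=> /(ler_wpM2l (ltW h0)); rewrite -(lerD2r (-1)) => /le_trans; apply; apply: eq_ler.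
by rewrite -natr1; field; rewrite !gt_eqF//; lra.
Qed.

(** The limit of [stirling_err]. *)
Definition stirling_const : R := ln (2 * pi) / 2.

(** The n ln n terms cancel. Since [stirling_err] has the same limit along n and 2n, this
    combination tends to that limit, which the Wallis bounds identify. *)
Lemma stirling_err_double n : (0 < n)%N ->
  2 * stirling_err n - stirling_err n.*2 = ln (2 * wallis n ^+ 2 / n%:R) / 2.
Proof.
move=> n0; have n0r : (0 : R) < n%:R by rewrite ltr0n.
have f0 j : (0 : R) < j`!%:R by rewrite ltr0n fact_gt0.
rewrite ln_div ?posrE ?mulr_gt0 ?exprn_gt0 ?wallis_gt0//.
rewrite lnM ?posrE ?exprn_gt0 ?wallis_gt0// lnXn ?wallis_gt0//.
rewrite /wallis ln_div ?posrE ?mulr_gt0 ?exprn_gt0//.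
rewrite lnM ?posrE ?exprn_gt0// !lnXn// (_ : 4 = 2 ^+ 2); last by rewrite expr2; ring.
rewrite lnXn// /stirling_err -muln2 natrM lnM ?posrE//.
by rewrite !mulr2n -[(_ + _) *+ n]mulr_natl; field.
Qed.

Lemma stirling_err_double_ge n : (0 < n)%N ->
  stirling_const <= 2 * stirling_err n - stirling_err n.*2.
Proof.
move=> n0; have n0r : (0 : R) < n%:R by rewrite ltr0n.
have pi0 := pi_gt0 R.
rewrite stirling_err_double// ler_pM2r ?invr_gt0//.
rewrite ler_ln ?posrE ?divr_gt0 ?mulr_gt0 ?exprn_gt0 ?wallis_gt0//.
by rewrite ler_pdivlMr// -mulrA ler_pM2l// wallis_ge.
Qed.

Lemma stirling_err_double_le n : (0 < n)%N ->
  2 * stirling_err n - stirling_err n.*2 <= stirling_const + (4 * n%:R)^-1.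
Proof.
move=> n0; have n0r : (0 : R) < n%:R by rewrite ltr0n.
have pi0 := pi_gt0 R.
have n2 : 0 < 1 + (2 * n%:R)^-1 :> R by rewrite addr_gt0// invr_gt0 mulr_gt0.
rewrite stirling_err_double//.
have : ln (2 * wallis n ^+ 2 / n%:R) <= ln (2 * pi * (1 + (2 * n%:R)^-1)) :> R.
  rewrite ler_ln ?posrE ?divr_gt0 ?mulr_gt0 ?exprn_gt0 ?wallis_gt0//.
  rewrite ler_pdivrMr// -!mulrA ler_pM2l// (le_trans (wallis_le n))// ler_pM2l//.
  by apply: eq_ler; field; rewrite gt_eqF.
have h2 : 0 <= 2^-1 :> R by [].
move=> /(ler_wpM2r h2) /le_trans; apply.
rewrite lnM ?posrE ?mulr_gt0// /stirling_const mulrDl lerD2l.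
have /le_ln1Dx : -1 < (2 * n%:R)^-1 :> R.
  by rewrite (lt_le_trans (ltrN10 R))// invr_ge0 mulr_ge0.
move=> /(ler_wpM2r h2) /le_trans; apply.
by apply: eq_ler; field; rewrite gt_eqF.
Qed.

Lemma stirling_err_le_add n k : (0 < n)%N -> stirling_err (n + k) <= stirling_err n.
Proof.
move=> n0; elim: k => [|k IH]; first by rewrite addn0.
by rewrite addnS (le_trans _ IH)// stirling_err_decr// addn_gt0 n0.
Qed.

Lemma stirling_err_ge_add n k : (0 < n)%N ->
  stirling_err n - (12 * n%:R)^-1 <= stirling_err (n + k) - (12 * (n + k)%:R)^-1.
Proof.
move=> n0; elim: k => [|k IH]; first by rewrite addn0.
by rewrite addnS (le_trans IH)// stirling_err_incr// addn_gt0 n0.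
Qed.

Lemma stirling_err_doubleB n : (0 < n)%N ->
  - (12 * n%:R)^-1 <= stirling_err n.*2 - stirling_err n <= 0.
Proof.
move=> n0; have n0r : (0 : R) < n%:R by rewrite ltr0n.
rewrite -addnn subr_le0 stirling_err_le_add// andbT.
have := stirling_err_ge_add n n n0.
have : 0 <= (12 * (n + n)%:R)^-1 :> R by rewrite invr_ge0 mulr_ge0.
set a := (12 * n%:R)^-1; set b := (12 * (n + n)%:R)^-1; lra.
Qed.

Lemma le_of_harmonic (a b c : R) (n : nat) : 0 <= c ->
  (forall N, (n <= N)%N -> (0 < N)%N -> a <= b + c / N%:R) -> a <= b.
Proof.
move=> c0 H; apply/ler_addgt0Pr => e e0.
pose N := maxn n.+1 (Num.truncn (c / e)).+1.
have N0 : (0 < N)%N by rewrite /N leq_max.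
have N0r : (0 : R) < N%:R by rewrite ltr0n.
apply: le_trans (H N _ N0) _; first by rewrite /N leq_max leqnSn.
rewrite lerD2l ler_pdivrMr// mulrC -ler_pdivrMr//.
have /andP[_ /ltW /le_trans] := truncn_itv (divr_ge0 c0 (ltW e0)); apply.
by rewrite ler_nat /N leq_max leqnn orbT.
Qed.

(** For N >= n, e_n >= e_N = (2 e_N - e_2N) + (e_2N - e_N), which is at least the constant minus
    1/(12 N); then N grows. *)
Lemma stirling_err_ge n : (0 < n)%N -> stirling_const <= stirling_err n.
Proof.
move=> n0; apply: (@le_of_harmonic _ _ 12^-1 n) => // N nN N0.
have := stirling_err_double_ge N N0; have /andP[+ _] := stirling_err_doubleB N N0.
have := stirling_err_le_add n (N - n) n0; rewrite subnKC//.
have -> : (12 * N%:R)^-1 = 12^-1 / N%:R :> R by field; rewrite pnatr_eq0 -lt0n.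
set a := _ / N%:R; lra.
Qed.

(** Same decomposition of e_N, now reached from the increasing sequence e_n - 1/(12 n), with an
    error 1/(4 N). *)
Lemma stirling_err_le n : (0 < n)%N ->
  stirling_err n <= stirling_const + (12 * n%:R)^-1.
Proof.
move=> n0; apply: (@le_of_harmonic _ _ 4^-1 n) => // N nN N0.
have := stirling_err_double_le N N0; have /andP[_] := stirling_err_doubleB N N0.
have := stirling_err_ge_add n (N - n) n0; rewrite subnKC//.
have -> : (4 * N%:R)^-1 = 4^-1 / N%:R :> R by field; rewrite pnatr_eq0 -lt0n.
have : 0 <= (12 * N%:R)^-1 :> R by rewrite invr_ge0 mulr_ge0.
set a := _ / N%:R; set b := (12 * n%:R)^-1; set d := (12 * N%:R)^-1; lra.
Qed.

Lemma ln_fact_ge n : (0 < n)%N ->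
  stirling_const + (n%:R + 2^-1) * ln n%:R - n%:R <= ln n`!%:R.
Proof. by move/stirling_err_ge; rewrite /stirling_err; lra. Qed.

Lemma ln_fact_le n : (0 < n)%N ->
  ln n`!%:R <= stirling_const + (n%:R + 2^-1) * ln n%:R - n%:R + (12 * n%:R)^-1.
Proof.
move/stirling_err_le; rewrite /stirling_err; set a := (12 * n%:R)^-1; lra.
Qed.

End stirling.

(** * Abel's identities *)

Section abel.
Context {R : comPzRingType}.

(** This is (-1)^N times the N-th forward difference of f at 0. *)
Definition findiff (N : nat) (f : nat -> R) : R :=
  \sum_(k < N.+1) (-1) ^+ k * 'C(N, k)%:R * f k.

Lemma findiffS N f : findiff N.+1 f = findiff N (fun k => f k - f k.+1).
Proof.
rewrite /findiff; under [RHS]eq_bigr do rewrite mulrBr.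
rewrite sumrB big_ord_recl bin0 /=.
have -> : \sum_(i < N.+1) (-1) ^+ i * 'C(N, i)%:R * f i =
    f 0%N + \sum_(i < N.+1) (-1) ^+ i.+1 * 'C(N, i.+1)%:R * f i.+1.
  transitivity (\sum_(i < N.+2) (-1) ^+ i * 'C(N, i)%:R * f i).
    by rewrite [RHS]big_ord_recr/= bin_small// mulr0 mul0r addr0.
  by rewrite big_ord_recl bin0/= expr0 !mul1r.
rewrite expr0 !mul1r -addrA -sumrB; congr (_ + _); apply: eq_bigr => i _.
by rewrite /bump/= add1n binS natrD exprS; ring.
Qed.

(** The difference k^p - (k+1)^p is a combination of the k^i with i < p, so order and degree drop
    together in the induction. *)
Lemma findiff_exp N p : (p <= N)%N ->
  findiff N (fun k => k%:R ^+ p) = if p == N then (-1) ^+ N * N`!%:R else 0.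
Proof.
elim: N p => [|N IH] p.
  by rewrite leqn0 => /eqP ->; rewrite /findiff big_ord1 bin0 !expr0 !mul1r.
move=> pN; rewrite findiffS.
transitivity (- \sum_(i < p) 'C(p, i)%:R * findiff N (fun k => k%:R ^+ i)).
  rewrite /findiff; under [in RHS]eq_bigr do rewrite mulr_sumr.
  rewrite exchange_big/= -sumrN; apply: eq_bigr => k _.
  rewrite -nat1r exprDn big_ord_recr/= subnn expr0 mul1r binn mulr1n.
  rewrite opprD addrCA subrr addr0 mulrN mulr_sumr; congr (- _).
  by apply: eq_bigr => i _; rewrite expr1n mul1r -mulr_natl; ring.
case: p pN => [|p] pN; first by rewrite big_ord0 oppr0.
rewrite big_ord_recr/= big1 ?add0r => [|i _]; last first.
  have iN : (i < N)%N by rewrite (leq_trans (ltn_ord i)).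
  by rewrite IH ?(ltnW iN)// ltn_eqF// mulr0.
rewrite IH// eqSS; case: eqP => [->|_]; last by rewrite mulr0 oppr0.
by rewrite binSn factS natrM exprS; ring.
Qed.

(** Both sides are the trinomial coefficient n! / (k! j! (n-k-j)!), or 0 when k + j > n. *)
Lemma bin_trinomial n k j : (k <= n)%N -> (j <= n)%N ->
  ('C(n, k) * 'C(n - k, j) = 'C(n, j) * 'C(n - j, k))%N.
Proof.
move=> kn jn; case: (leqP (k + j) n) => [kjn|]; last first.
  by move=> kjn; rewrite (@bin_small (n - k)) ?(@bin_small (n - j)) ?muln0//; lia.
have k0 := fact_gt0 k; have j0 := fact_gt0 j; have l0 := fact_gt0 (n - k - j).
have H1 := bin_fact kn; have H2 := bin_fact jn.
have H3 : ('C(n - k, j) * (j`! * (n - k - j)`!) = (n - k)`!)%N by rewrite bin_fact//; lia.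
have H4 : ('C(n - j, k) * (k`! * (n - j - k)`!) = (n - j)`!)%N by rewrite bin_fact//; lia.
rewrite subnAC in H4.
apply/eqP; rewrite -(eqn_pmul2r k0) -(eqn_pmul2r j0) -(eqn_pmul2r l0); apply/eqP.
nia.
Qed.

Lemma sum_ord_trunc (F : nat -> R) a b : (a <= b)%N ->
  (forall i, (a <= i)%N -> F i = 0) -> \sum_(i < b) F i = \sum_(i < a) F i.
Proof.
move=> ab F0; rewrite (big_ord_widen b F ab) [RHS]big_mkcond/=.
by apply: eq_bigr => i _; case: ltnP => // /F0.
Qed.

(** Expands (n - k)^(n - k) in powers of n and -k and exchanges the sums; for suitable g the inner
    sum becomes a finite difference of order n - j. *)
Lemma abel_expand (g : nat -> R) n :
  \sum_(k < n.+1) 'C(n, k)%:R * g k * (n - k)%:R ^+ (n - k) =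
  \sum_(j < n.+1) 'C(n, j)%:R * n%:R ^+ j *
     \sum_(k < (n - j).+1) 'C(n - j, k)%:R * g k * (- k%:R) ^+ (n - j - k).
Proof.
transitivity (\sum_(k < n.+1) \sum_(j < n.+1)
   'C(n, k)%:R * 'C(n - k, j)%:R * (n%:R ^+ j * g k * (- k%:R) ^+ (n - k - j))).
  apply: eq_bigr => k _; have kn : (k <= n)%N by rewrite -ltnS.
  rewrite (natrB _ kn) addrC exprDn.
  (* Binomials vanish outside the triangle, so both sums may run over the whole square before the
     exchange. *)
  rewrite (@sum_ord_trunc (fun j => 'C(n, k)%:R * 'C(n - k, j)%:R *
     (n%:R ^+ j * g k * (- k%:R) ^+ (n - k - j))) (n - k).+1); last 2 first.
  - by rewrite ltnS leq_subr.
  - by move=> i ik; rewrite (@bin_small (n - k))// mulr0 mul0r.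
  by rewrite mulr_sumr; apply: eq_bigr => i _; rewrite -mulr_natl; ring.
rewrite exchange_big/=; apply: eq_bigr => j _; have jn : (j <= n)%N by rewrite -ltnS.
rewrite mulr_sumr -(@sum_ord_trunc (fun k => 'C(n, j)%:R * n%:R ^+ j *
   ('C(n - j, k)%:R * g k * (- k%:R) ^+ (n - j - k))) (n - j).+1 n.+1); last 2 first.
- by rewrite ltnS leq_subr.
- by move=> i ij; rewrite (@bin_small (n - j))// !mul0r mulr0.
apply: eq_bigr => k _; have kn : (k <= n)%N by rewrite -ltnS.
have := congr1 (fun x => x%:R : R) (bin_trinomial _ _ _ kn jn).
by rewrite !natrM => E; rewrite E subnAC; ring.
Qed.

(** For g k = k^k the inner sum is, up to sign, the N-th difference of k^N, hence N!. *)
Lemma abel_sum_exp n :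
  \sum_(k < n.+1) 'C(n, k)%:R * k%:R ^+ k * (n - k)%:R ^+ (n - k) =
  \sum_(j < n.+1) ('C(n, j) * (n - j)`!)%:R * n%:R ^+ j :> R.
Proof.
rewrite (abel_expand (fun k => k%:R ^+ k)); apply: eq_bigr => j _.
rewrite natrM; set N := (n - j)%N; set S := \sum_(k < _) _.
suff -> : S = N`!%:R by ring.
rewrite /S; transitivity ((-1) ^+ N * findiff N (fun k => k%:R ^+ N)).
  rewrite /findiff mulr_sumr; apply: eq_bigr => k _.
  have kN : (k <= N)%N by rewrite -ltnS.
  rewrite (exprNn _ (N - k)) -[N in _ = _ * (_ * _ ^+ N)](subnK kN) exprD.
  rewrite -[N in _ = (-1) ^+ N * _](subnK kN) exprD.
  have : (-1) ^+ k * (-1) ^+ k = 1 :> R by rewrite -expr2 sqrr_sign.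
  move=> s1; transitivity ((((-1) ^+ k * (-1) ^+ k) *
      ((-1) ^+ (N - k) * 'C(N, k)%:R * (k%:R ^+ (N - k) * k%:R ^+ k))) : R).
    by rewrite s1; ring.
  ring.
by rewrite findiff_exp// eqxx mulrA -expr2 sqrr_sign mul1r.
Qed.

(** For g k = k^(k-1) the inner sum is, up to sign, the N-th difference of k^(N-1), hence 0, less
    its term at k = 0; by 0^0 = 1 that term survives only for N = 1. The value 0 at k = 0 is imposed
    because [0%:R ^+ 0.-1] is 1. *)
Lemma abel_sum_pred n : (0 < n)%N ->
  \sum_(k < n.+1) 'C(n, k)%:R * (if k == 0 :> nat then 0 else k%:R ^+ k.-1) *
     (n - k)%:R ^+ (n - k) =
  n%:R ^+ n :> R.
Proof.
move=> n0; pose g k : R := if k == 0%N then 0 else k%:R ^+ k.-1.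
rewrite (abel_expand g).
have H N : \sum_(k < N.+1) 'C(N, k)%:R * g k * (- k%:R) ^+ (N - k) = (N == 1)%:R.
  case: N => [|N]; first by rewrite big_ord1 /g/= mulr0 mul0r.
  rewrite big_ord_recl /g/= mulr0 mul0r add0r.
  have E : findiff N.+1 (fun k => k%:R ^+ N) = 0 by rewrite findiff_exp// ltn_eqF.
  transitivity ((-1) ^+ N.+1 * (findiff N.+1 (fun k => k%:R ^+ N) - 0 ^+ N)); last first.
    rewrite E sub0r; case: (N) => [|M]; first by rewrite expr0 expr1 mulN1r opprK.
    by rewrite expr0n/= oppr0 mulr0.
  rewrite /findiff [in RHS]big_ord_recl bin0 expr0 !mul1r/= addrAC subrr add0r mulr_sumr.
  apply: eq_bigr => k _; rewrite /bump/= add1n subSS.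
  have kN : (k <= N)%N by rewrite -ltnS.
  rewrite (exprNn _ (N - k)) -[N in _ = _ * (_ * _ ^+ N)](subnK kN) exprD.
  rewrite -[N in _ = (-1) ^+ N.+1 * _](subnK kN) -addnS exprD.
  have : (-1) ^+ k.+1 * (-1) ^+ k.+1 = 1 :> R by rewrite -expr2 sqrr_sign.
  move=> s1; transitivity ((((-1) ^+ k.+1 * (-1) ^+ k.+1) *
      ((-1) ^+ (N - k) * 'C(N.+1, k.+1)%:R * (k.+1%:R ^+ (N - k) * k.+1%:R ^+ k))) : R).
    by rewrite s1; ring.
  by rewrite exprD; ring.
under eq_bigr do rewrite H.
case: n n0 => // n _; rewrite big_ord_recr/= subnn mulr0 addr0.
rewrite big_ord_recr/= subSnn/= mulr1 binSn exprS big1 ?add0r// => i _.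
by rewrite gtn_eqF ?mulr0//; have := ltn_ord i; lia.
Qed.

End abel.

(** * Truncated power series of the tree function *)

Section abel_poly.
Context {R : realType}.

Definition abel_coef (k : nat) : R := k%:R ^+ k / k`!%:R.
(* The coefficients of the tree function T = X e^T. *)
Definition tree_coef (k : nat) : R := if k == 0%N then 0 else k%:R ^+ k.-1 / k`!%:R.
(** Truncations stand in for power series: coefficients of degree below N in their sums and products
    are exact. *)
Definition abel_poly N : {poly R} := \poly_(i < N) abel_coef i.
Definition tree_poly N : {poly R} := \poly_(i < N) tree_coef i.

Lemma fact_neq0 k : k`!%:R != 0 :> R.
Proof. by rewrite pnatr_eq0 -lt0n fact_gt0. Qed.

Lemma bin_factV n k : (k <= n)%N ->
  'C(n, k)%:R / n`!%:R = k`!%:R^-1 * (n - k)`!%:R^-1 :> R.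
Proof.
move=> kn; have := congr1 (fun x => x%:R : R) (bin_fact kn).
rewrite !natrM => <-; field.
by rewrite !fact_neq0 pnatr_eq0 -lt0n bin_gt0 kn.
Qed.

Lemma poly_conv_bin (f g : nat -> R) N n : (n < N)%N ->
  (\poly_(i < N) (f i / i`!%:R) * \poly_(i < N) (g i / i`!%:R))`_n =
  n`!%:R^-1 * \sum_(k < n.+1) 'C(n, k)%:R * f k * g (n - k)%N.
Proof.
move=> nN; rewrite coefM mulr_sumr; apply: eq_bigr => k _.
have kn : (k <= n)%N by rewrite -ltnS.
rewrite !coef_poly (leq_ltn_trans kn nN) (leq_ltn_trans (leq_subr _ _) nN).
have := bin_factV n k kn; rewrite mulrC => E.
by rewrite !mulrA E; ring.
Qed.

Lemma abel_poly_sqr N n : (n < N)%N ->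
  (abel_poly N ^+ 2)`_n = \sum_(j < n.+1) n%:R ^+ j / j`!%:R.
Proof.
move=> nN; rewrite expr2 (poly_conv_bin (fun k => k%:R ^+ k) (fun k => k%:R ^+ k))//.
rewrite abel_sum_exp mulr_sumr; apply: eq_bigr => j _.
have jn : (j <= n)%N by rewrite -ltnS.
transitivity ('C(n, j)%:R / n`!%:R * ((n - j)`!%:R * n%:R ^+ j) : R).
  by rewrite natrM; ring.
by rewrite bin_factV//; field; rewrite !fact_neq0.
Qed.

(** A = 1 / (1 - T) below degree N; for n > 0 this is [abel_sum_pred] divided by n!. *)
Lemma tree_abel N n : (n < N)%N ->
  (abel_poly N - tree_poly N * abel_poly N - 1)`_n = 0.
Proof.
move=> nN; rewrite !coefB coef1.
have -> : tree_poly N = \poly_(i < N) ((if i == 0%N then 0 else i%:R ^+ i.-1) / i`!%:R).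
  by apply/polyP => i; rewrite !coef_poly /tree_coef; case: eqP; rewrite ?mul0r.
rewrite (poly_conv_bin _ (fun k => k%:R ^+ k))// coef_poly nN /abel_coef.
case: n nN => [|n] nN.
  by rewrite big_ord1/= mulr0 mul0r mulr0 fact0 expr0 divr1 subr0 subrr.
by rewrite abel_sum_pred// subr0 mulrC subrr.
Qed.

Lemma polyXdvd_coef (p : {poly R}) N :
  (forall n, (n < N)%N -> p`_n = 0) -> exists q, p = q * 'X^N.
Proof.
move=> p0; exists (drop_poly N p); rewrite -[LHS](poly_take_drop N).
rewrite (_ : take_poly N p = 0) ?add0r//.
by apply/polyP => i; rewrite coef_take_poly coef0; case: ifP => // /p0.
Qed.

(* With T the tree function, A = 1/(1 - T) and X T' = A - 1, hence X A' = A^3 - A^2. *)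
Lemma abel_poly_deriv N : (0 < N)%N -> exists q,
  'X * (abel_poly N)^`() = abel_poly N ^+ 3 - abel_poly N ^+ 2 + q * 'X^N.
Proof.
move=> N0; have [q] := polyXdvd_coef _ _ (tree_abel N).
set A := abel_poly N; set T := tree_poly N => E.
(* Exact even for the truncations, as X d/dX preserves degrees and k k^(k-1) = k^k. *)
have XT : 'X * T^`() = A - 1.
  apply/polyP => i; rewrite coefXM coef_deriv coefB coef1 !coef_poly.
  case: i => [|i] /=; first by rewrite N0 /abel_coef expr0 fact0 divr1 subrr.
  rewrite /tree_coef/= subr0; case: ifP => _; last by rewrite mul0rn.
  by rewrite /abel_coef -[LHS]mulr_natl exprS mulrA.
have E1 : A - T * A = 1 + q * 'X^N by rewrite -E; ring.
(* Differentiating the error q X^N leaves a term in X^(N-1); the factor X restores X^N. *)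
have E2 : 'X * (A^`() * (1 - T)) = A * ('X * T^`()) + ('X * q^`() + N%:R * q) * 'X^N.
  have D1 : A^`() - (T^`() * A + T * A^`()) = q^`() * 'X^N + q * (N%:R * 'X^(N.-1)).
    by rewrite -derivM -derivB E1 derivD derivC add0r derivM derivXn mulr_natl.
  transitivity ('X * (A^`() - (T^`() * A + T * A^`())) + A * ('X * T^`())); first by ring.
  rewrite D1; have -> : 'X^N = 'X * 'X^(N.-1) :> {poly R} by rewrite -exprS prednK.
  ring.
exists (A * ('X * q^`() + N%:R * q) - 'X * A^`() * q).
rewrite XT in E2.
(* Multiplied by A, the left-hand side of [E2] contains A - T A, which is 1 modulo X^N. *)
have : 'X * A^`() * (A - T * A) = A * ('X * (A^`() * (1 - T))) by ring.
rewrite E1 E2 => E3.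
transitivity ('X * A^`() * (1 + q * 'X^N) - 'X * A^`() * q * 'X^N); first by ring.
rewrite E3; ring.
Qed.

(** X d/dX multiplies the n-th coefficient by n, and X (A^m)' = m A^(m-1) (A^3 - A^2) modulo X^N. *)
Lemma abel_poly_rec N m n : (n < N)%N -> (0 < m)%N ->
  n%:R * (abel_poly N ^+ m)`_n =
  m%:R * ((abel_poly N ^+ m.+2)`_n - (abel_poly N ^+ m.+1)`_n).
Proof.
move=> nN m0; have [|q E] := abel_poly_deriv N; first exact: leq_ltn_trans nN.
set A := abel_poly N in E *.
have -> : n%:R * (A ^+ m)`_n = ('X * (A ^+ m)^`())`_n.
  rewrite coefXM coef_deriv; case: n nN => [|n] _ /=; first by rewrite mul0r.
  by rewrite mulr_natl.
rewrite -coefB mulr_natl -coefMn.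
have -> : 'X * (A ^+ m)^`() = (A ^+ m.+2 - A ^+ m.+1) *+ m + (A ^+ m.-1 * q *+ m) * 'X^N.
  rewrite deriv_exp; case: m m0 => // m _ /=.
  transitivity ((A ^+ m * ('X * A^`())) *+ m.+1).
    by rewrite mulrnAr; congr (_ *+ _); ring.
  by rewrite E mulrnAl -mulrnDl; congr (_ *+ _); rewrite !exprS; ring.
by rewrite coefD coefMXn nN addr0.
Qed.

End abel_poly.

(** * Upper bound on Shtarkov sums *)

Section shtarkov.
Context {R : realType}.

Lemma expR_ge_sum n (x : R) : 0 <= x -> \sum_(k < n) x ^+ k / k`!%:R <= expR x.
Proof.
move=> x0; have := fun H => @nondecreasing_cvgn_le R (series (exp_coeff x)) H (is_cvg_series_exp_coeff x) n.
rewrite /series/= big_mkord; apply => i j ij.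
rewrite -subr_ge0 sub_series ij sumr_ge0// => k _.
by rewrite divr_ge0 ?exprn_ge0.
Qed.

(** Equality holds at j = 0. Passing to j + 1 multiplies the left side by (n-1-j) / n and the right
    side by n / (n+1+j), and (n-1-j) (n+1+j) <= n^2. *)
Lemma exp_coeff_sym n j : (j < n)%N ->
  (n%:R : R) ^+ (n.-1 - j) / (n.-1 - j)`!%:R <= n%:R ^+ (n + j) / (n + j)`!%:R.
Proof.
move=> jn; have n0 : (0 : R) < n%:R by rewrite ltr0n; lia.
elim: j jn => [|j IH] jn.
  rewrite subn0 addn0; case: n n0 jn => // n n0 _ /=.
  rewrite factS natrM exprS; apply: eq_ler; field.
  by rewrite fact_neq0 addrC natr1 pnatr_eq0.
have {}IH := IH (ltnW jn).
rewrite addnS factS natrM exprS.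
have -> : n%:R * n%:R ^+ (n + j) / ((n + j).+1%:R * (n + j)`!%:R) =
    n%:R / (n + j).+1%:R * (n%:R ^+ (n + j) / (n + j)`!%:R) :> R.
  by rewrite -mulf_div.
have nj0 : (0 : R) < (n + j).+1%:R by [].
have q0 : 0 <= n%:R / (n + j).+1%:R :> R by rewrite divr_ge0.
apply: le_trans (ler_wpM2l q0 IH).
have [r ->] : exists r, (n = j + r.+2)%N by exists (n - j.+2)%N; lia.
have -> : ((j + r.+2).-1 - j.+1 = r)%N by lia.
have -> : ((j + r.+2).-1 - j = r.+1)%N by lia.
have m0 : (0 : R) < (j + r.+2)%:R by rewrite ltr0n addnS.
rewrite factS natrM exprS.
have -> : (j + r.+2)%:R / (j + r.+2 + j).+1%:R * ((j + r.+2)%:R * (j + r.+2)%:R ^+ r / (r.+1%:R * r`!%:R))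
  = ((j + r.+2)%:R ^+ 2 / ((j + r.+2 + j).+1%:R * r.+1%:R)) * ((j + r.+2)%:R ^+ r / r`!%:R) :> R.
  have : (r.+1%:R : R) != 0 by rewrite pnatr_eq0.
  have : (j + r.+2 + j).+1%:R != 0 :> R by rewrite pnatr_eq0.
  move: (r.+1%:R : R) ((j + r.+2 + j).+1%:R : R) (fact_neq0 (R := R) r) => a b c a0 b0.
  by field; rewrite a0 b0 c.
rewrite ler_peMl ?divr_ge0 ?exprn_ge0// ler_pdivlMr ?mulr_gt0// mul1r.
by rewrite -natrM -natrX ler_nat; nia.
Qed.

(* The terms n^k / k! with k < n are dominated by their mirror images with n <= k < 2n. *)
Lemma exp_half_sum n : 2 * \sum_(k < n) n%:R ^+ k / k`!%:R <= expR n%:R :> R.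
Proof.
apply: le_trans (expR_ge_sum (n + n) _ (ler0n _ _)).
rewrite big_split_ord/= mulr_natl mulr2n lerD2l.
rewrite (reindex_inj rev_ord_inj)/=; apply: ler_sum => j _.
by have := exp_coeff_sym n j (ltn_ord j); rewrite -subn1 subnAC subn1 -subnS.
Qed.

(* The sum of #nu e^(- G nu) over the nu in N^m of sum n, provided that n < N; since 0 ^ 0 = 1,
   n = 0 is not exceptional. *)
Definition shtarkov N m n : R := n`!%:R / n%:R ^+ n * (abel_poly N ^+ m)`_n.

(* K_(j+1) = sqrt(2 pi) 2^(-(j+1)/2) / Gamma((j+1)/2) *)
Definition shtarkov_const j : R :=
  Num.sqrt (2 * pi) / (2 * gauss_val j * Num.sqrt 2 ^+ j.+1).

Lemma shtarkov_const_gt0 j : 0 < shtarkov_const j.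
Proof.
by rewrite divr_gt0 ?mulr_gt0 ?exprn_gt0 ?gauss_val_gt0 ?sqrtr_gt0 ?mulr_gt0 ?pi_gt0.
Qed.

Lemma shtarkov_constSS j : shtarkov_const j.+2 = shtarkov_const j / j.+1%:R.
Proof.
rewrite /shtarkov_const gauss_valS !exprS.
have s2 : Num.sqrt 2 * Num.sqrt 2 = 2 :> R by rewrite -expr2 sqr_sqrtr.
have := gauss_val_gt0 (R := R) j.
have : 0 < Num.sqrt 2 :> R by rewrite sqrtr_gt0.
move=> s0 g0.
transitivity (Num.sqrt (2 * pi) / (2 * (j.+1%:R / 2 * gauss_val j) *
   ((Num.sqrt 2 * Num.sqrt 2) * (Num.sqrt 2 * Num.sqrt 2 ^+ j))) : R).
  by rewrite !mulrA.
have p0 : 0 < Num.sqrt 2 ^+ j :> R by rewrite exprn_gt0.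
have c0 : 0 < j.+1%:R :> R by [].
move: (j.+1%:R : R) c0 p0 => c c0 p0.
by rewrite s2; field; rewrite !gt_eqF.
Qed.

(** Cross-multiplied and squared, this is [gauss_val_ratio] at j + 1. It brings the two terms of
    [shtarkov_rec] to a common constant. *)
Lemma shtarkov_const_ratio j :
  shtarkov_const j.+1 <= Num.sqrt j.+2%:R * shtarkov_const j.+2.
Proof.
have g1 := gauss_val_gt0 (R := R) j.+1; have g2 := gauss_val_gt0 (R := R) j.+2.
have s0 : 0 < Num.sqrt 2 :> R by rewrite sqrtr_gt0.
have p0 : 0 < Num.sqrt 2 ^+ j.+2 :> R by rewrite exprn_gt0.
have H := gauss_val_ratio (R := R) j.+1.
rewrite /shtarkov_const [Num.sqrt 2 ^+ j.+3]exprS.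
move: (gauss_val j.+1) (gauss_val j.+2) g1 g2 H => a b a0 b0 H.
have E : b * Num.sqrt 2 <= Num.sqrt j.+2%:R * a.
  rewrite -(@ler_pXn2r _ 2)// ?nnegrE ?mulr_ge0 ?sqrtr_ge0 ?(ltW a0) ?(ltW b0)//.
  rewrite !exprMn !sqr_sqrtr//.
  by rewrite -ler_pdivlMr// mulrAC.
rewrite [leRHS]mulrCA ler_wpM2l ?sqrtr_ge0//.
have d1 : 0 < 2 * a * Num.sqrt 2 ^+ j.+2 by apply: mulr_gt0 => //; apply: mulr_gt0.
have d2 : 0 < 2 * b * (Num.sqrt 2 * Num.sqrt 2 ^+ j.+2).
  by apply: mulr_gt0; apply: mulr_gt0.
rewrite (ler_pdivlMr _ _ d2) mulrC (ler_pdivrMr _ _ d1).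
rewrite [leLHS](_ : _ = (b * Num.sqrt 2) * (2 * Num.sqrt 2 ^+ j.+2)); last by ring.
rewrite [leRHS](_ : _ = (Num.sqrt j.+2%:R * a) * (2 * Num.sqrt 2 ^+ j.+2)); last by ring.
by rewrite ler_pM2r// mulr_gt0.
Qed.

Lemma expnn_neq0 n : n%:R ^+ n != 0 :> R.
Proof. by case: n => [|n]; rewrite ?expr0 ?oner_neq0// expf_neq0// pnatr_eq0. Qed.

Lemma shtarkov1 N n : (n < N)%N -> shtarkov N 1 n = 1.
Proof.
move=> nN; rewrite /shtarkov expr1 coef_poly nN /abel_coef; field.
by rewrite fact_neq0 expnn_neq0.
Qed.

Lemma shtarkov2 N n : (n < N)%N ->
  shtarkov N 2 n = 1 + n`!%:R / n%:R ^+ n * \sum_(k < n) n%:R ^+ k / k`!%:R.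
Proof.
move=> nN; rewrite /shtarkov abel_poly_sqr// big_ord_recr/= mulrDr addrC; congr (_ + _).
by field; rewrite fact_neq0 expnn_neq0.
Qed.

Lemma shtarkov_rec N m n : (n < N)%N ->
  shtarkov N m.+3 n = shtarkov N m.+2 n + n%:R / m.+1%:R * shtarkov N m.+1 n.
Proof.
move=> nN; have E := abel_poly_rec (R := R) N m.+1 n nN isT.
have m0 : (m.+1%:R : R) != 0 by rewrite pnatr_eq0.
have {}E : (abel_poly N ^+ m.+3)`_n = (abel_poly N ^+ m.+2)`_n +
    n%:R / m.+1%:R * (abel_poly N ^+ m.+1)`_n :> R.
  apply: (mulfI m0); rewrite mulrDr mulrA (mulrCA _ n%:R) divff// mulr1 E; ring.
by rewrite /shtarkov E; ring.
Qed.

Lemma ln_2pi_half : expR (@stirling_const R) = Num.sqrt (2 * pi).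
Proof.
have p0 : 0 < 2 * pi :> R by rewrite mulr_gt0 ?pi_gt0.
rewrite /stirling_const -powR12_sqrt ?ltW// -[X in X `^ _]lnK ?posrE//.
by rewrite -expRM.
Qed.

Lemma fact_exp_le n : (0 < n)%N ->
  n`!%:R / n%:R ^+ n * expR n%:R <=
  Num.sqrt (2 * pi) * Num.sqrt n%:R * expR (12 * n%:R)^-1 :> R.
Proof.
move=> n0; have n0r : (0 : R) < n%:R by rewrite ltr0n.
have := ln_fact_le (R := R) n n0; rewrite -ler_expR lnK ?posrE ?ltr0n ?fact_gt0// => H.
rewrite mulrAC ler_pdivrMr ?exprn_gt0//.
apply: le_trans (ler_wpM2r (expR_ge0 _) H) _; apply: eq_ler.
rewrite -expRD -ln_2pi_half -(powR12_sqrt (ltW n0r)) /powR gt_eqF// -[n%:R ^+ n]lnK; last first.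
  by rewrite posrE exprn_gt0.
by rewrite -!expRD lnXn// -[ln _ *+ n]mulr_natl; congr expR; field; rewrite gt_eqF.
Qed.

(** For n > 0, [exp_half_sum] and Stirling's formula bound S_2(n) by 1 + sqrt(2 pi n) exp(1/(12 n))
    / 2. The right-hand side is sqrt(pi) + sqrt(2 pi n) / 2, and the gap between 1 and sqrt(pi)
    absorbs the exponential. *)
Lemma shtarkov2_le N n : (n < N)%N ->
  shtarkov N 2 n <= shtarkov_const 1 * (Num.sqrt 2 + Num.sqrt n%:R).
Proof.
move=> nN; have s2 : Num.sqrt 2 ^+ 2 = 2 :> R by rewrite sqr_sqrtr.
have s20 : 0 < Num.sqrt 2 :> R by rewrite sqrtr_gt0.
have p0 := pi_gt0 R; have p2 := pi_ge2 R.
have spi : Num.sqrt 2 <= Num.sqrt pi :> R by rewrite ler_wsqrtr.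
have s2_14 : 14/10 <= Num.sqrt 2 :> R.
  by rewrite -(@ler_pXn2r _ 2)// ?nnegrE ?sqrtr_ge0// s2; lra.
have s2_15 : Num.sqrt 2 <= 15/10 :> R.
  by rewrite -(@ler_pXn2r _ 2)// ?nnegrE ?sqrtr_ge0// s2; lra.
have -> : shtarkov_const 1 = Num.sqrt (2 * pi) / 2.
  by rewrite /shtarkov_const /= s2; field.
rewrite shtarkov2// sqrtrM//; case: n nN => [|n] nN.
  (* At n = 0 the sum is empty and the claim is 1 <= sqrt(pi). *)
  rewrite big_ord0 mulr0 addr0 sqrtr0 addr0.
  rewrite [leRHS](_ : _ = Num.sqrt 2 ^+ 2 / 2 * Num.sqrt pi); last by ring.
  by rewrite s2; lra.
have n0r : (0 : R) < n.+1%:R by [].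
have n1 : (1 : R) <= n.+1%:R by rewrite ler1n.
set F := n.+1`!%:R / _; set S := \sum_(k < _) _.
have F0 : 0 < F by rewrite divr_gt0 ?exprn_gt0 ?ltr0n ?fact_gt0.
have H1 : 2 * (F * S) <= Num.sqrt (2 * pi) * Num.sqrt n.+1%:R * expR (12 * n.+1%:R)^-1.
  apply: le_trans (fact_exp_le n.+1 isT); rewrite mulrCA ler_pM2l//; exact: exp_half_sum.
set s := Num.sqrt n.+1%:R in H1 *.
have s1 : 1 <= s by rewrite -sqrtr1 ler_sqrt.
have sE : s ^+ 2 = n.+1%:R by rewrite sqr_sqrtr.
(* From exp(y) <= 1 / (1 - y) at y = 1/(12 s^2); the resulting excess over s is largest at s = 1,
   where it is 12/11 - 1. *)
have H2 : s * expR (12 * n.+1%:R)^-1 <= s + 1 / 11.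
  have E : expR (12 * n.+1%:R)^-1 <= (1 - (12 * n.+1%:R)^-1)^-1 :> R.
    rewrite -[expR _]invrK -expRN lef_pV2 ?posrE ?expR_gt0 ?expR_ge1Dx//.
    by rewrite subr_gt0 invf_lt1 ?mulr_gt0//; lra.
  apply: le_trans (ler_wpM2l (ltW (lt_le_trans ltr01 s1)) E) _.
  rewrite -sE ler_pdivrMr; last first.
    by rewrite subr_gt0 invf_lt1 ?mulr_gt0 ?exprn_gt0 ?(lt_le_trans ltr01 s1)// sE; lra.
  rewrite -subr_ge0 (_ : _ - _ = ((s - 1) * (12 * s + 1)) / (132 * s ^+ 2)); last first.
    by field; rewrite gt_eqF// (lt_le_trans ltr01 s1).
  by rewrite divr_ge0 ?mulr_ge0 ?sqr_ge0//; lra.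
rewrite sqrtrM// -mulrA in H1.
set e := expR _ in H1 H2; set t := Num.sqrt 2 in s2 s20 spi s2_14 s2_15 H1 *.
set p := Num.sqrt pi in spi H1 *.
have H3 : t * p * (s * e) <= t * p * (s + 1 / 11).
  by rewrite ler_wpM2l// mulr_ge0// ?sqrtr_ge0// ltW.
have tp : t * p <= 15 / 10 * p by rewrite ler_wpM2r// sqrtr_ge0.
have H4 : 2 * (F * S) <= t * p * (s + 1 / 11) by exact: le_trans H1 H3.
have -> : t * p / 2 * (t + s) = p + t * p * s / 2.
  transitivity (t ^+ 2 / 2 * p + t * p * s / 2); first by ring.
  by rewrite s2 divff// mul1r.
move: H4 tp; rewrite mulrDr; set x := t * p; set y := x * s; set z := F * S; lra.
Qed.

(** The recurrence reaches back two ranks, so two consecutive ranks are proved together. With r =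
    sqrt(n) and a = sqrt(j+3) + r, the step reduces to sqrt(j+2) a + r^2 <= a^2, which follows from
    sqrt(j+2) <= a - r and r <= a. *)
Lemma shtarkov_le N j n : (n < N)%N ->
  shtarkov N j.+1 n <=
  shtarkov_const j * (Num.sqrt j.+1%:R + Num.sqrt n%:R) ^+ j.
Proof.
move=> nN.
have c0 : shtarkov_const 0 = 1.
  rewrite /shtarkov_const /= expr1 sqrtrM//; field.
  by rewrite !gt_eqF ?sqrtr_gt0 ?pi_gt0.
suff [//] : (shtarkov N j.+1 n <= shtarkov_const j * (Num.sqrt j.+1%:R + Num.sqrt n%:R) ^+ j) /\
  (shtarkov N j.+2 n <= shtarkov_const j.+1 * (Num.sqrt j.+2%:R + Num.sqrt n%:R) ^+ j.+1).
elim: j => [|j [IH1 IH2]].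
  by rewrite shtarkov1// c0 expr0 mulr1 expr1; split => //; exact: shtarkov2_le.
split=> //; rewrite shtarkov_rec//.
set r := Num.sqrt n%:R in IH1 IH2 *; set a := Num.sqrt j.+3%:R + r.
have r0 : 0 <= r by exact: sqrtr_ge0.
have rE : n%:R = r ^+ 2 by rewrite sqr_sqrtr.
have a0 : 0 <= a by rewrite addr_ge0 ?sqrtr_ge0.
have k0 := shtarkov_const_gt0 j.+2.
have kS := shtarkov_constSS j.
have m0 : 0 < j.+1%:R :> R by [].
have a2 : Num.sqrt j.+2%:R + r <= a by rewrite lerD2r ler_wsqrtr// ler_nat.
have a1 : Num.sqrt j.+1%:R + r <= a by rewrite lerD2r ler_wsqrtr// ler_nat ltnW.
have ge_0 (x : R) : 0 <= Num.sqrt x + r by rewrite addr_ge0 ?sqrtr_ge0.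
have H2 : shtarkov N j.+2 n <= shtarkov_const j.+2 * (Num.sqrt j.+2%:R * a ^+ j.+1).
  apply: le_trans IH2 _; rewrite mulrA [_ * Num.sqrt _]mulrC.
  apply: ler_pM; rewrite ?exprn_ge0//; first exact/ltW/shtarkov_const_gt0.
    exact: shtarkov_const_ratio.
  by rewrite lerXn2r// nnegrE.
have H1 : n%:R / j.+1%:R * shtarkov N j.+1 n <= shtarkov_const j.+2 * (r ^+ 2 * a ^+ j).
  apply: (@le_trans _ _ (n%:R / j.+1%:R * (shtarkov_const j * a ^+ j))).
    rewrite ler_wpM2l ?divr_ge0//; apply: le_trans IH1 _.
    rewrite ler_wpM2l ?lerXn2r ?nnegrE//; exact/ltW/shtarkov_const_gt0.
  rewrite kS rE; apply: eq_ler; move: (j.+1%:R : R) m0 => c c0'; field; by rewrite gt_eqF.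
apply: le_trans (lerD H2 H1) _.
rewrite -mulrDr ler_pM2l//.
rewrite (_ : _ + _ = (Num.sqrt j.+2%:R * a + r ^+ 2) * a ^+ j); last by rewrite exprS; ring.
rewrite (_ : a ^+ j.+2 = a ^+ 2 * a ^+ j); last by rewrite -exprD.
rewrite ler_wpM2r ?exprn_ge0//.
have : Num.sqrt j.+2%:R * a <= (a - r) * a by rewrite ler_wpM2r// lerBrDr.
have : r * r <= r * a by rewrite ler_wpM2l// lerDr sqrtr_ge0.
by rewrite !expr2 mulrBl; set u := r * a; set v := _ * a; set w := r * r; set z := a * a; lra.
Qed.

End shtarkov.

(** * Count vectors *)

Lemma prod_fact_dvd (I : Type) (s : seq I) (f : I -> nat) :
  (\prod_(i <- s) (f i)`! %| (\sum_(i <- s) f i)`!)%N.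
Proof.
elim: s => [|x s IH]; first by rewrite !big_nil.
rewrite !big_cons -(@bin_fact (f x + \sum_(i <- s) f i) (f x)) ?leq_addr//.
by rewrite addKn dvdn_mull// dvdn_mul.
Qed.

Section count_vectors.
Context {R : realType}.

Lemma nb_realE m (nu : 'cV[nat]_m) :
  (nb_real nu)%:R = (csum nu)`!%:R / \prod_i (nu i ord0)`!%:R :> R.
Proof.
have d := prod_fact_dvd (ordinal m) (index_enum _) (fun i => nu i ord0).
rewrite /nb_real -natr_prod -[in RHS](divnK d) natrM mulfK//.
by rewrite pnatr_eq0 -lt0n prodn_gt0// => i; rewrite fact_gt0.
Qed.

Lemma nb_real_gt0 m (nu : 'cV[nat]_m) : (0 : R) < (nb_real nu)%:R.
Proof.
rewrite nb_realE divr_gt0 ?ltr0n ?fact_gt0//.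
by apply: prodr_gt0 => i _; rewrite ltr0n fact_gt0.
Qed.

Lemma vsum_realv m (nu : 'cV[nat]_m) : vsum (realv R nu) = (csum nu)%:R.
Proof. by rewrite /vsum /csum natr_sum; apply: eq_bigr => i _; rewrite mxE. Qed.

(** At n = 0 the conventions 0 ln 0 = 0 and 0^0 = 1 agree. *)
Lemma expR_mul_ln (n : nat) : expR (n%:R * ln n%:R) = n%:R ^+ n :> R.
Proof.
case: n => [|n]; first by rewrite mul0r expR0.
by rewrite expRM_natl lnK ?posrE.
Qed.

Lemma expR_entropy m (nu : 'cV[nat]_m) :
  expR (entropy (realv R nu)) =
  (csum nu)%:R ^+ (csum nu) / \prod_i (nu i ord0)%:R ^+ (nu i ord0).
Proof.
rewrite /entropy vsum_realv expRD expR_mul_ln expRN expR_sum mulrC; congr (_ / _).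
by apply: eq_bigr => i _; rewrite mxE expR_mul_ln.
Qed.

Lemma nb_real_entropy m (nu : 'cV[nat]_m) :
  (nb_real nu)%:R = expR (entropy (realv R nu)) *
    ((csum nu)`!%:R / (csum nu)%:R ^+ (csum nu) * \prod_i abel_coef (nu i ord0)).
Proof.
rewrite nb_realE expR_entropy /abel_coef big_split/= prodfV.
have p0 : \prod_i (nu i ord0)%:R ^+ (nu i ord0) != 0 :> R.
  by apply/prodf_neq0 => i _; exact: expnn_neq0.
have q0 : \prod_i (nu i ord0)`!%:R != 0 :> R.
  by apply/prodf_neq0 => i _; exact: fact_neq0.
by field; rewrite p0 q0 expnn_neq0.
Qed.

Lemma coef_abel_polyX N m n :
  (abel_poly N ^+ m)`_n =
  \sum_(f : {ffun 'I_m -> 'I_N} | (\sum_i f i)%N == n) \prod_i abel_coef (f i) :> R.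
Proof.
have -> : abel_poly N ^+ m = \prod_(j < m) \sum_(i < N) (abel_coef i *: 'X^i) :> {poly R}.
  by rewrite prodr_const card_ord /abel_poly poly_def.
rewrite bigA_distr_bigA/= coef_sum [RHS]big_mkcond/=; apply: eq_bigr => f _.
rewrite scaler_prod prodrXr coefZ coefXn eq_sym.
by case: eqP; rewrite ?mulr1 ?mulr0.
Qed.

(** Embeds a finite type, so that a sum over a set of bounded count vectors becomes a finite sum. *)
Definition cvec_of N m (f : {ffun 'I_m -> 'I_N}) : 'cV[nat]_m := \col_i (f i : nat).

Lemma cvec_of_inj N m : injective (@cvec_of N m).
Proof.
move=> f g /colP fg; apply/ffunP => i; apply: val_inj.
by have := fg i; rewrite !mxE.
Qed.

Lemma csum_cvec_of N m (f : {ffun 'I_m -> 'I_N}) : csum (cvec_of N m f) = (\sum_i f i)%N.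
Proof. by apply: eq_bigr => i _; rewrite mxE. Qed.

Lemma esum_finType (I : finType) (Q : set I) (a : I -> R) :
  (forall i, 0 <= a i) ->
  (\esum_(i in Q) (a i)%:E = (\sum_(i | i \in Q) a i)%:E)%E.
Proof.
move=> a0; rewrite esum_mkcond esum_fset; last 2 first.
- exact: finite_finset.
- by move=> i _; case: ifP; rewrite ?lee_fin.
rewrite (_ : [set: I] = [set` index_enum I]); last first.
  by apply/seteqP; split => // i _ /=; rewrite mem_index_enum.
rewrite -fsbig_seq ?index_enum_uniq//= -big_mkcond/= sumEFin.
by congr EFin; apply: eq_bigl.
Qed.

(** An entry is at most the sum of its vector, so B is the image of a set in a finite type and its
    [esum] is a real S. Each term is e^(G nu) times a weight, with G nu <= c, and the weights of all
    vectors of sum n add up to [shtarkov]. *)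
Lemma nb_real_set_le m (B : set 'cV[nat]_m) (n1 n2 : nat) (c : R) :
  (forall nu, B nu -> (n1 <= csum nu <= n2)%N /\ entropy (realv R nu) <= c) ->
  exists2 S : R, nb_real_set R B = S%:E &
    0 <= S <= expR c * \sum_(n1 <= n < n2.+1) shtarkov n2.+1 m n.
Proof.
move=> HB; pose h := @cvec_of n2.+1 m.
have BE : B = h @` (h @^-1` B).
  apply/seteqP; split => [nu Bnu|nu [f Bf <-]//].
  have lt_n2 i : (nu i ord0 < n2.+1)%N.
    have [/andP[_ le2] _] := HB _ Bnu; rewrite ltnS (leq_trans _ le2)//.
    by rewrite /csum (bigD1 i)//= leq_addr.
  have hE : h [ffun i => Ordinal (lt_n2 i)] = nu.
    by apply/colP => i; rewrite mxE ffunE.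
  by exists [ffun i => Ordinal (lt_n2 i)] => //=; rewrite hE.
pose S : R := \sum_(f | f \in h @^-1` B) (nb_real (h f))%:R.
exists S.
  rewrite /nb_real_set BE esum_image; last by move=> f g _ _; exact: cvec_of_inj.
  by rewrite (esum_finType _ (h @^-1` B) (fun f => (nb_real (h f))%:R))// -BE.
apply/andP; split; first by apply: sumr_ge0.
pose w (f : {ffun 'I_m -> 'I_n2.+1}) : R := \prod_i abel_coef (f i).
have w0 f : 0 <= w f.
  by apply: prodr_ge0 => i _; rewrite /abel_coef divr_ge0 ?exprn_ge0.
have -> : \sum_(n1 <= n < n2.+1) shtarkov n2.+1 m n =
    \sum_(f : {ffun 'I_m -> 'I_n2.+1} | (n1 <= \sum_i f i <= n2)%N)
      ((\sum_i f i)%N`!%:R / (\sum_i f i)%N%:R ^+ (\sum_i f i)%N * w f) :> R.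
  (* Groups the vectors by their sum, which [inord] turns into an element of ['I_n2.+1]. *)
  rewrite big_geq_mkord/= (partition_big (fun f : {ffun 'I_m -> 'I_n2.+1} => inord (\sum_i f i)%N : 'I_n2.+1)
    (fun j => n1 <= j)%N)/=; last first.
    by move=> f /andP[f1 f2]; rewrite inordK.
  apply: eq_bigr => j jn.
  rewrite /shtarkov coef_abel_polyX mulr_sumr.
  apply: eq_big => [f|f /eqP ->//].
  apply/eqP/andP => [fj|[/andP[f1 f2] /eqP <-]]; last by rewrite inordK.
  rewrite fj jn -ltnS ltn_ord; split => //; apply/eqP/val_inj.
  by rewrite /= inordK.
rewrite mulr_sumr /S big_mkcond [leRHS]big_mkcond/=; apply: ler_sum => f _.
case: ifPn => [|_]; last by case: ifP => // _; rewrite !mulr_ge0 ?expR_ge0 ?invr_ge0 ?exprn_ge0.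
rewrite inE/= => Bf; have [] := HB _ Bf; rewrite csum_cvec_of => -> ec.
rewrite nb_real_entropy csum_cvec_of (_ : \prod_i abel_coef _ = w f); last first.
  by apply: eq_bigr => i _; rewrite mxE.
by rewrite ler_wpM2r ?ler_expR// !mulr_ge0 ?invr_ge0 ?exprn_ge0.
Qed.

End count_vectors.

(** * Telescoping of the Shtarkov bounds *)

Section shtarkov_sum.
Context {R : realType}.

(** Tangent inequality for the convex function y^((k+2)/2) between y = a^2 and y = b^2; the
    induction on k keeps to integer powers. *)
Lemma exprn_gap k (a b : R) : 0 <= a -> a <= b ->
  k.+2%:R / 2 * a ^+ k * (b ^+ 2 - a ^+ 2) <= b ^+ k.+2 - a ^+ k.+2.
Proof.
move=> a0 ab; have b0 := le_trans a0 ab.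
elim: k => [|k IH]; first by rewrite expr0 mulr1 divff// mul1r.
rewrite (exprS b k.+2) (exprS a k.+2).
apply: (@le_trans _ _ (b * (k.+2%:R / 2 * a ^+ k * (b ^+ 2 - a ^+ 2)) + a ^+ k.+2 * (b - a))).
  rewrite -subr_ge0.
  rewrite [leRHS](_ : _ = a ^+ k * (b - a) ^+ 2 * (k.+2%:R / 2 * (b + a) - a / 2)); last first.
    by rewrite -[k.+3]addn1 natrD !exprS; field.
  apply: mulr_ge0; first by rewrite mulr_ge0 ?exprn_ge0 ?subr_ge0.
  have : 1 * (b + a) <= k.+2%:R / 2 * (b + a).
    by rewrite ler_wpM2r ?addr_ge0// ler_pdivlMr// mul1r ler_nat.
  rewrite mul1r; set z := _ * (b + a); lra.
have -> : b * b ^+ k.+2 - a * a ^+ k.+2 = b * (b ^+ k.+2 - a ^+ k.+2) + a ^+ k.+2 * (b - a) by ring.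
by rewrite lerD2r ler_wpM2l.
Qed.

(** With m = j + 1, a = sqrt(m) + sqrt(n) and b = sqrt(m) + sqrt(n+1), one has b^2 - a^2 >= 1, so
    [exprn_gap] bounds a^j by 2/(j+2) times b^(j+2) - a^(j+2). *)
Lemma shtarkov_sum_lt N j n1 n2 (s1 s2 : R) : (n1 <= n2.+1)%N -> (n2 < N)%N ->
  0 <= s1 -> s1 <= n1%:R -> n2%:R < s2 + 1 ->
  \sum_(n1 <= n < n2.+1) shtarkov N j.+1 n <
  shtarkov_const j * (2 / j.+2%:R) * C3 j.+1 s1 s2.
Proof.
move=> n12 n2N s10 s1n s2n.
pose r : R := Num.sqrt j.+1%:R; pose g (x : R) := (r + Num.sqrt x) ^+ j.+2.
have r0 : 0 <= r by exact: sqrtr_ge0.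
have k0 := shtarkov_const_gt0 (R := R) j.
have rx0 x : 0 <= r + Num.sqrt x by rewrite addr_ge0 ?sqrtr_ge0.
have K0 : 0 < shtarkov_const j * (2 / j.+2%:R) :> R by apply: mulr_gt0 => //; exact: divr_gt0.
apply: (@le_lt_trans _ _ (shtarkov_const j * (2 / j.+2%:R) *
    \sum_(n1 <= n < n2.+1) (g n.+1%:R - g n%:R))); last first.
  rewrite ltr_pM2l// telescope_sumr// /C3 -/r -/(g (s2 + 2)) -/(g s1).
  (* Strictness comes from n2 + 1 < s2 + 2. *)
  apply: ltr_leB; last by rewrite lerXn2r ?nnegrE// lerD2l ler_wsqrtr.
  rewrite ltrXn2r ?nnegrE//= ltrD2l ltr_sqrt; last by rewrite (le_lt_trans (ler0n R n2))//; lra.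
  by rewrite -natr1; lra.
rewrite mulr_sumr big_nat [leRHS]big_nat; apply: ler_sum => n /andP[_ nn2].
have nN : (n < N)%N by rewrite (leq_trans nn2).
apply: le_trans (shtarkov_le N j n nN) _.
rewrite -mulrA ler_pM2l// -/r.
have ab : r + Num.sqrt n%:R <= r + Num.sqrt n.+1%:R.
  by rewrite lerD2l ler_wsqrtr// ler_nat.
have := exprn_gap j _ _ (rx0 _) ab; rewrite -/(g _) -/(g _) => H.
have {H} : j.+2%:R / 2 * (r + Num.sqrt n%:R) ^+ j <= g n.+1%:R - g n%:R.
  apply: le_trans H; rewrite ler_peMr ?mulr_ge0 ?divr_ge0 ?exprn_ge0//.
  rewrite !sqrrD !sqr_sqrtr//.
  have : r * Num.sqrt n%:R <= r * Num.sqrt n.+1%:R.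
    by rewrite ler_wpM2l// ler_wsqrtr// ler_nat.
  rewrite -natr1 !mulr2n; lra.
have c0 : 0 <= 2 / j.+2%:R :> R by rewrite divr_ge0.
move=> /(ler_wpM2l c0); apply: le_trans; apply: eq_ler.
by move: (j.+2%:R : R) (ltr0n R j.+2) => c /= cp; field; rewrite gt_eqF.
Qed.

End shtarkov_sum.

(** * Entropy of the optimal count vector *)

Section entropy_bounds.
Context {R : realType}.

(** The argument u of ln is at most 1 exactly when w <= W. Each case has its own bound on ln u, both
    exact to second order at 1. *)
Lemma ln_ratio_le (w W : R) : 0 < w -> 0 < W ->
  w * ln (w * (W + 1) / (W * (w + 1))) <=
  (w - W) / (W + 1) + (w - W) ^+ 2 / (2 * w * W ^+ 2).
Proof.
move=> w0 W0; set u := w * (W + 1) / _.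
have w1 : 0 < w + 1 by lra.
have W1 : 0 < W + 1 by lra.
have u0 : 0 < u by rewrite divr_gt0 ?mulr_gt0.
have [wW|Ww] := leP w W.
  have u1 : u <= 1 by rewrite ler_pdivrMr ?mulr_gt0// mul1r; nra.
  apply: le_trans (ler_wpM2l (ltW w0) (ln_le_sub_div _ u0 u1)) _.
  have d0 : 0 < 2 * w * W + w + W by rewrite !addr_gt0 ?mulr_gt0.
  rewrite -subr_ge0 (_ : _ - _ = (w - W) ^+ 2 * (2 * w * W + (w + W) * (W + 1)) /
    (2 * w * W ^+ 2 * (W + 1) * (2 * w * W + w + W))); last first.
    rewrite /u; field.
    by rewrite !gt_eqF// ?addr_gt0 ?mulr_gt0.
  apply: divr_ge0; first apply: mulr_ge0 (sqr_ge0 _) _.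
    by rewrite ltW// addr_gt0 ?mulr_gt0// addr_gt0.
  by rewrite ltW// !mulr_gt0// exprn_gt0.
have u1 : 1 <= u by rewrite ler_pdivlMr ?mulr_gt0// mul1r; nra.
apply: le_trans (ler_wpM2l (ltW w0) (ln_le_sub_inv _ u1)) _.
rewrite -subr_ge0 (_ : _ - _ = (w - W) ^+ 2 * ((w + 1) * (W + 1) - w * W) /
    (2 * w * W ^+ 2 * (W + 1) * (w + 1))); last first.
  by rewrite /u; field; rewrite !gt_eqF.
apply: divr_ge0; first by apply: mulr_ge0 (sqr_ge0 _) _; nra.
by rewrite ltW// !mulr_gt0// exprn_gt0.
Qed.

(* w ln (1 + 1/w) is concave, but adding 1/(2w) makes it convex; this is the tangent line at W. *)
Lemma ln_tangent (w W : R) : 0 < w -> 0 < W ->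
  W * ln (1 + W^-1) + (2 * W)^-1
    + (ln (1 + W^-1) - (W + 1)^-1 - (2 * W ^+ 2)^-1) * (w - W)
  <= w * ln (1 + w^-1) + (2 * w)^-1.
Proof.
move=> w0 W0; have := ln_ratio_le w W w0 W0.
have w1 : 0 < w + 1 by lra.
have W1 : 0 < W + 1 by lra.
have -> : w * (W + 1) / (W * (w + 1)) = (1 + W^-1) / (1 + w^-1).
  field; rewrite !gt_eqF//; lra.
have iw : 0 < 1 + w^-1 by rewrite addr_gt0 ?invr_gt0.
have iW : 0 < 1 + W^-1 by rewrite addr_gt0 ?invr_gt0.
rewrite ln_div ?posrE//; set a := ln (1 + W^-1); set b := ln (1 + w^-1).
rewrite -subr_ge0 => H; rewrite -subr_ge0; apply: le_trans H _; apply: eq_ler.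
by field; rewrite !gt_eqF.
Qed.

(** As W is the mean of the w_i, the linear terms of the tangents at W sum to 0. *)
Lemma ln_jensen m (w : 'I_m -> R) (W : R) : (forall i, 0 < w i) -> 0 < W ->
  \sum_i w i = m%:R * W ->
  m%:R * (W * ln (1 + W^-1) + (2 * W)^-1) <=
  \sum_i (w i * ln (1 + (w i)^-1) + (2 * w i)^-1).
Proof.
move=> w0 W0 sw; apply: le_trans (ler_sum _ (fun i _ => ln_tangent (w i) W (w0 i) W0)).
rewrite big_split/= -mulr_sumr sumrB sw !sumr_const card_ord.
by rewrite -[X in _ <= X + _]mulr_natl -[W *+ m]mulr_natl subrr mulr0 addr0.
Qed.

(** Gibbs' inequality: apply ln q <= q - 1 at q = S p_i / w_i, the S p_i - w_i having sum 0. *)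
Lemma gibbs m (w p : 'I_m -> R) : (forall i, 0 < w i) -> (forall i, 0 < p i) ->
  \sum_i p i = 1 ->
  (\sum_i w i) * ln (\sum_i w i) - \sum_i w i * ln (w i) <= - (\sum_i w i * ln (p i)).
Proof.
move=> w0 p0 p1; set S := \sum_i w i.
suff : \sum_i w i * (ln S + ln (p i) - ln (w i)) <= 0.
  under eq_bigr do rewrite mulrBr mulrDr.
  by rewrite sumrB big_split/= -mulr_suml -/S; lra.
case: m w p w0 p0 p1 @S => [|m] w p w0 p0 p1 S.
  by rewrite big_ord0.
have S0 : 0 < S by rewrite /S big_ord_recl ltr_pwDl// sumr_ge0// => i _; rewrite ltW.
apply: (@le_trans _ _ (\sum_i (S * p i - w i))); last first.
  by rewrite sumrB -mulr_sumr p1 mulr1 subrr.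
apply: ler_sum => i _.
have Sp0 : 0 < S * p i by exact: mulr_gt0.
have q0 : 0 < S * p i / w i by exact: divr_gt0.
have -> : ln S + ln (p i) - ln (w i) = ln (S * p i / w i).
  by rewrite ln_div ?posrE// lnM ?posrE.
have -> : S * p i - w i = w i * (S * p i / w i - 1) by field; rewrite gt_eqF.
rewrite ler_pM2l// -[X in ln X](subrK 1) addrC le_ln1Dx//; lra.
Qed.

Lemma entropy_shift m (x nu : 'I_m -> R) (s n : R) :
  (0 < m)%N -> (forall i, 1 < x i) -> (forall i, x i - 1 <= nu i) ->
  \sum_i x i = s -> \sum_i nu i = n ->
  (s * ln s - \sum_i x i * ln (x i)) + \sum_i ln (x i / s)
   - 2^-1 * (\sum_i (x i - 1)^-1 - m%:R / (s / m%:R - 1)) <=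
  n * ln n - \sum_i nu i * ln (nu i).
Proof.
move=> m0 x1 xnu xs nun; pose w i := x i - 1.
have w0 i : 0 < w i by rewrite subr_gt0.
have m0r : (0 : R) < m%:R by rewrite ltr0n.
have nu0 i : 0 < nu i by exact: lt_le_trans (w0 i) (xnu i).
have x0 i : 0 < x i by exact: lt_trans ltr01 (x1 i).
have sum_gt0 (f : 'I_m -> R) : (forall i, 0 < f i) -> 0 < \sum_i f i.
  case: m {x nu x1 xnu xs nun w w0 m0r nu0 x0} f m0 => // m f _ f0.
  by rewrite big_ord_recl ltr_pwDl// sumr_ge0// => i _; rewrite ltW.
have n0 : 0 < n by rewrite -nun sum_gt0.
have s0 : 0 < s by rewrite -xs sum_gt0.
set S := \sum_i w i; have SE : S = s - m%:R.
  by rewrite /S sumrB xs sumr_const card_ord.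
have S0 : 0 < S by exact: sum_gt0.
pose W := S / m%:R.
have W0 : 0 < W by rewrite divr_gt0.
(* Monotonicity of G: by [gibbs], G(w) is at most the cross entropy of w relative to nu / n, in
   which w_i may be raised to nu_i because ln(nu_i / n) <= 0. *)
have step1 : S * ln S - \sum_i w i * ln (w i) <= n * ln n - \sum_i nu i * ln (nu i).
  have p1 : \sum_i nu i / n = 1 by rewrite -mulr_suml nun divff// gt_eqF.
  apply: le_trans (gibbs m w (fun i => nu i / n) w0 _ p1) _.
    by move=> i; rewrite divr_gt0.
  have -> : n * ln n - \sum_i nu i * ln (nu i) = - \sum_i nu i * ln (nu i / n).
    have -> : \sum_i nu i * ln (nu i / n) = \sum_i nu i * ln (nu i) - n * ln n.
      rewrite -nun mulr_suml nun -sumrB; apply: eq_bigr => i _.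
      by rewrite ln_div ?posrE// mulrBr.
    by rewrite opprB.
  rewrite lerN2; apply: ler_sum => i _.
  have L0 : ln (nu i / n) <= 0.
    rewrite ln_le0// ler_pdivrMr// mul1r -nun (bigD1 i)//= lerDl.
    by rewrite sumr_ge0// => j _; rewrite ltW.
  exact: ler_wnM2r L0 _ _ (xnu i).
apply: le_trans step1.
have sw : \sum_i w i = m%:R * W by rewrite /W mulrC divfK ?gt_eqF.
have := ln_jensen m w W w0 W0 sw.
have -> : m%:R / (s / m%:R - 1) = m%:R / W.
  by rewrite /W SE; congr (_ / _); field; rewrite gt_eqF.
have lnxs : \sum_i ln (x i / s) = \sum_i ln (x i) - m%:R * ln s.
  under eq_bigr do rewrite ln_div ?posrE//.
  by rewrite sumrB sumr_const card_ord mulr_natl.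
(* Since 1 + 1/w_i = x_i / w_i, the term w_i ln(1 + 1/w_i) is (x_i - 1) ln x_i - w_i ln w_i. *)
have lw : \sum_i (w i * ln (1 + (w i)^-1) + (2 * w i)^-1) =
    \sum_i x i * ln (x i) - \sum_i ln (x i) - \sum_i w i * ln (w i) +
    2^-1 * \sum_i (x i - 1)^-1.
  rewrite mulr_sumr -!sumrB -big_split/=; apply: eq_bigr => i _.
  have -> : 1 + (w i)^-1 = x i / w i by rewrite /w; field; rewrite gt_eqF// (w0 i).
  rewrite ln_div ?posrE// invfM -/(w i) [in LHS]/w.
  by rewrite -/(w i) /w; ring.
have lW : ln (1 + W^-1) = ln s - ln S.
  rewrite -ln_div ?posrE//; congr ln.
  by rewrite (_ : s = S + m%:R) ?SE ?subrK// /W SE; field; rewrite !gt_eqF// -SE.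
rewrite lw lW lnxs.
have mW : m%:R * W = S by rewrite -sw.
have -> : m%:R * (W * (ln s - ln S) + (2 * W)^-1) = S * (ln s - ln S) + 2^-1 * (m%:R / W).
  by rewrite -mW; field; rewrite gt_eqF.
by rewrite SE; set a := \sum_i _; lra.
Qed.

End entropy_bounds.

Section optimal_count.
Context {R : realType}.

(* A single nu_i may exceed x_i + 1, by up to (n - s) x_i / s, but the sum of the nu_i
   is at most s + 1, whereas that of the x_i + 1 is s + m. *)
Lemma sum_ln_count_le m (x nu : 'I_m -> R) (s n : R) :
  (2 <= m)%N -> (forall i, 1 < x i) -> (forall i, 0 < nu i) ->
  (forall i, nu i <= n * (x i / s) + 1) ->
  \sum_i x i = s -> \sum_i nu i = n -> s <= n <= s + 1 ->
  \sum_i ln (nu i) <= \sum_i ln (x i + 1).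
Proof.
move=> m2 x1 nu0 nux xs nun /andP[sn ns].
(* As m >= 2 there is another coordinate, and it exceeds 1. *)
have x1s i : x i + 1 <= s.
  have [j ji] : exists j, j != i.
    have [->|i0] := eqVneq i (Ordinal (ltnW m2)); first by exists (Ordinal m2).
    by exists (Ordinal (ltnW m2)); rewrite eq_sym.
  rewrite -xs (bigD1 i)//= lerD2l (bigD1 j)//= ler_wpDr ?(ltW (x1 j))//.
  by rewrite sumr_ge0// => k _; rewrite ltW// (lt_trans ltr01).
pose th := n - s.
have th0 : 0 <= th by rewrite subr_ge0.
have th1 : th <= 1 by rewrite /th; lra.
have s0 : 0 < s.
  by have := x1s (Ordinal m2); have := x1 (Ordinal m2); lra.
pose e i := nu i - x i - 1.
have e_le i : e i <= th * x i / s.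
  have -> : th * x i / s = n * (x i / s) - x i by rewrite /th; field; rewrite gt_eqF.
  by have := nux i; rewrite /e; lra.
(* Replaces the denominator x_i + 1 by s, so that the e_i can be summed: a negative e_i only gains,
   a positive one costs at most the last term. *)
have H i : e i / (x i + 1) <= e i / s + th * (s - x i) / s ^+ 2.
  have xi := x1 i; have xs1 := x1s i; have xp : 0 < x i + 1 by lra.
  have [e0|e0] := ltP (e i) 0.
    apply: (@le_trans _ _ (e i / s)).
      by rewrite ler_wnM2l ?(ltW e0)// lef_pV2 ?posrE.
    by rewrite lerDl divr_ge0 ?exprn_ge0 ?(ltW s0)// mulr_ge0//; lra.
  have -> : e i / (x i + 1) = e i / s + e i * (s - x i - 1) / (s * (x i + 1)).
    by field; rewrite !gt_eqF.
  rewrite lerD2l.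
  have f0 : 0 <= (s - x i - 1) / (s * (x i + 1)).
    by rewrite divr_ge0 ?mulr_ge0 ?(ltW s0) ?(ltW xp)//; lra.
  rewrite -mulrA; apply: le_trans (ler_wpM2r f0 (e_le i)) _.
  rewrite -subr_ge0 (_ : _ - _ = th * (s - x i + x i) / (s ^+ 2 * (x i + 1))); last first.
    by field; rewrite !gt_eqF.
  by rewrite divr_ge0 ?mulr_ge0 ?exprn_ge0 ?(ltW s0) ?(ltW xp)//; lra.
rewrite -subr_le0 -sumrB.
apply: (@le_trans _ _ (\sum_i (e i / s + th * (s - x i) / s ^+ 2))).
  apply: ler_sum => i _; have xi := x1 i; have xp : 0 < x i + 1 by lra.
  apply: le_trans (H i).
  rewrite -ln_div ?posrE//.
  have -> : nu i / (x i + 1) = 1 + e i / (x i + 1) by rewrite /e; field; rewrite gt_eqF.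
  rewrite le_ln1Dx//.
  have : 0 < nu i / (x i + 1) by rewrite divr_gt0.
  have -> : nu i / (x i + 1) = 1 + e i / (x i + 1) by rewrite /e; field; rewrite gt_eqF.
  lra.
have mE : \sum_(i < m) (1 : R) = m%:R by rewrite sumr_const card_ord.
have sE : \sum_(i < m) s = m%:R * s by rewrite sumr_const card_ord mulr_natl.
rewrite big_split/= -!mulr_suml -mulr_sumr !sumrB xs nun mE sE -/th.
(* The e_i sum to th - m, so th <= 1 makes the total nonpositive. *)
rewrite (_ : _ + _ = m%:R * (th - 1) / s); last first.
  by rewrite /th; field; rewrite gt_eqF.
by rewrite pmulr_lle0 ?invr_gt0// pmulr_rle0 ?ltr0n ?(leq_trans _ m2)//; lra.
Qed.

(** Rounding moves an entry by at most 1/2 and a correction moves it by 1 the opposite way, so it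
    ends within 1 of its target; the |d| corrections restore the sum n. *)
Lemma optimal_countP m (n : int) (chi : 'cV[R]_m) (nu : 'cV[nat]_m) :
  is_optimal_count n chi nu ->
  (csum nu)%:Z = n /\
  forall i, n%:~R * chi i ord0 - 1 <= (nu i ord0)%:R <= n%:~R * chi i ord0 + 1.
Proof.
move=> [t tr]; set d := _ - n => -[d0 dn dp].
have ti i : - 2^-1 <= n%:~R * chi i ord0 - (t i ord0)%:~R <= 2^-1.
  by have := tr i; rewrite mxE ler_norml.
have cs : (csum nu)%:Z = \sum_i (nu i ord0)%:Z 
    by rewrite /csum -[LHS]natz natr_sum; apply: eq_bigr => i _; rewrite natz.
have nuR i : (nu i ord0)%:R = ((nu i ord0)%:Z)%:~R :> R by rewrite -pmulrn.
have cardE (D : {set 'I_m}) : \sum_i (i \in D : nat)%:Z = #|D|%:Z.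
  rewrite -sum1_card -[RHS]natz natr_sum [RHS]big_mkcond/=.
  by apply: eq_bigr => i _; case: (i \in D).
case: (ltrgtP d 0) => hd.
- have [D [cD tD nuE]] := dn hd; split.
    rewrite cs; under eq_bigr do rewrite nuE.
    by rewrite big_split/= cardE cD /d opprB addrC subrK.
  move=> i; rewrite nuR nuE intrD; have := ti i; case: (boolP (i \in D)) => [/tD|_].
    by rewrite mxE; set y := n%:~R * _; set z := (t i 0)%:~R; rewrite -/z /=; lra.
  by set y := n%:~R * _; set z := (t i 0)%:~R; rewrite -/z /=; lra.
- have [D [cD tD nuE]] := dp hd; split.
    rewrite cs; under eq_bigr do rewrite nuE.
    by rewrite sumrB cardE cD /d opprB addrC subrK.
  move=> i; rewrite nuR nuE intrB; have := ti i; case: (boolP (i \in D)) => [/tD|_].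
    by rewrite mxE; set y := n%:~R * _; set z := (t i 0)%:~R; rewrite -/z /=; lra.
  by set y := n%:~R * _; set z := (t i 0)%:~R; rewrite -/z /=; lra.
- split.
    rewrite cs; under eq_bigr do rewrite d0//.
    by apply/eqP; rewrite -subr_eq0; apply/eqP.
  by move=> i; rewrite nuR d0//; have := ti i; set y := n%:~R * _; set z := (t i 0)%:~R; rewrite -/z; lra.
Qed.

End optimal_count.

(** * Lower bound on the numerator *)

Section count_lower_bound.
Context {R : realType}.

Lemma C2_ln m (x : 'cV[R]_m) : 0 < vsum x -> (forall i, 0 < x i ord0) ->
  C2 x = expR (2^-1 * ln (vsum x) + \sum_i ln (x i ord0 / vsum x)
               - 2^-1 * \sum_i ln (x i ord0 + 1)).
Proof.
move=> s0 x0.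
have sq (y : R) : 0 < y -> Num.sqrt y = expR (2^-1 * ln y).
  by move=> y0; rewrite -powR12_sqrt ?ltW// /powR gt_eqF.
rewrite /C2 sq// -addrA expRD mulr_sumr -sumrB expR_sum; congr (_ * _).
apply: eq_bigr => i _; rewrite expRB lnK ?posrE ?divr_gt0// -sq//.
by rewrite addr_gt0.
Qed.

(** Stirling from below for n! and from above for each nu_i!, where 1/(12 nu_i) <= 1/12 yields
    e^(-m/12). The half-logarithms, through n >= s and [sum_ln_count_le], and the ln chi_i of
    [entropy_shift] make up C2. *)
Lemma nb_real_ge m (x : 'cV[R]_m) (nu : 'cV[nat]_m) :
  (2 <= m)%N -> (forall i, 1 < x i ord0) ->
  vsum x <= (csum nu)%:R <= vsum x + 1 ->
  (forall i, (csum nu)%:R * (x i ord0 / vsum x) - 1 <= (nu i ord0)%:R <=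
             (csum nu)%:R * (x i ord0 / vsum x) + 1) ->
  expR ((1 - m%:R) * stirling_const - m%:R / 12) * (C2 x * C4 x) *
    expR (entropy x) <= (nb_real nu)%:R.
Proof.
move=> m2 x1 /andP[sn ns] nux.
have x0 i : 0 < x i ord0 by exact: lt_trans ltr01 (x1 i).
set s := vsum x in sn ns nux *; set n : R := (csum nu)%:R in sn ns nux *.
have s0 : 0 < s.
  have i0 := Ordinal m2.
  rewrite /s /vsum (bigD1 i0)//= ltr_pwDl// sumr_ge0// => i _; exact: ltW.
have n0 : 0 < n by exact: lt_le_trans sn.
have yx i : x i ord0 <= n * (x i ord0 / s).
  rewrite mulrCA ler_peMr ?(ltW (x0 i))// ler_pdivlMr// mul1r//.
have xnu i : x i ord0 - 1 <= (nu i ord0)%:R.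
  by have /andP[+ _] := nux i; apply: le_trans; rewrite lerD2r.
have nu0 i : (0 : R) < (nu i ord0)%:R.
  by apply: lt_le_trans (xnu i); rewrite subr_gt0.
have nu0n i : (0 < nu i ord0)%N by rewrite -(ltr0n R).
have sumnu : \sum_i (nu i ord0)%:R = n by rewrite /n /csum natr_sum.
have prodln (f : 'I_m -> R) : (forall i, 0 < f i) -> ln (\prod_i f i) = \sum_i ln (f i).
  move=> f0; rewrite -[RHS]expRK expR_sum; congr ln.
  by apply: eq_bigr => i _; rewrite lnK ?posrE.
have H1 := entropy_shift m (fun i => x i ord0) (fun i => (nu i ord0)%:R) s n
  (ltnW m2) x1 xnu erefl sumnu.
have H2 := sum_ln_count_le m (fun i => x i ord0) (fun i => (nu i ord0)%:R) s n
  m2 x1 nu0 _ erefl sumnu _.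
have {}H2 : \sum_i ln (nu i ord0)%:R <= \sum_i ln (x i ord0 + 1).
  by apply: H2; [move=> i; have /andP[] := nux i | rewrite sn ns].
have H3 : stirling_const + (n + 2^-1) * ln n - n <= ln (csum nu)`!%:R.
  by rewrite ln_fact_ge// -(ltr0n R).
have H4 : \sum_i ln (nu i ord0)`!%:R <=
   m%:R * stirling_const + \sum_i (nu i ord0)%:R * ln (nu i ord0)%:R
   + 2^-1 * (\sum_i ln (nu i ord0)%:R) - n + m%:R / 12.
  have cst (c : R) : \sum_(i < m) c = m%:R * c by rewrite sumr_const card_ord mulr_natl.
  rewrite -(cst stirling_const) -(cst 12^-1) -sumnu mulr_sumr -!big_split/= -sumrB -big_split/=.
  apply: ler_sum => i _; apply: le_trans (ln_fact_le _ (nu0n i)) _.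
  have : (12 * (nu i ord0)%:R)^-1 <= 12^-1 :> R.
    by rewrite lef_pV2 ?posrE ?mulr_gt0// ler_peMr// ler1n.
  set a := (12 * _)^-1; set b := _%:R; lra.
have H5 : ln s <= ln n by rewrite ler_ln.
rewrite C2_ln// /C4 -!expRD nb_realE -[leRHS]lnK; last first.
  rewrite posrE divr_gt0 ?ltr0n ?fact_gt0//.
  by apply: prodr_gt0 => i _; rewrite ltr0n fact_gt0.
rewrite ler_expR ln_div ?posrE ?ltr0n ?fact_gt0//; last first.
  by apply: prodr_gt0 => i _; rewrite ltr0n fact_gt0.
rewrite prodln; last by move=> i; rewrite ltr0n fact_gt0.
rewrite /entropy -/s.
move: H1 H2 H3 H4 H5.
set t1 := s * ln s; set t2 := \sum_i x i 0 * ln _; set t3 := \sum_i ln (x i ord0 / s).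
set t4 := \sum_i _^-1; set t5 := n * ln n; set t6 := \sum_i (nu i ord0)%:R * _.
rewrite mulrDl -/t5 mulrBl mul1r.
lra.
Qed.

End count_lower_bound.

(** Reconciles the constants of [shtarkov_sum_lt] and [nb_real_ge]: Gamma(m/2) cancels against K_m,
    which is [shtarkov_const m.-1], and (2 pi)^((1-m)/2) e^(-m/12) remains. *)
Lemma gamma_prefactorE (R : realType) (m : nat) : (2 <= m)%N ->
  m.+1%:R * expR (- (m%:R / 12)) * GammaR (m%:R / 2) / (2 * pi `^ (m%:R / 2)) *
    (shtarkov_const m.-1 * (2 / m.+1%:R)) =
  expR ((1 - m%:R) * stirling_const - m%:R / 12) :> R.
Proof.
case: m => [//|[//|k]] _ /=; have p0 := pi_gt0 R; have p2 : 0 < 2 * pi :> R by rewrite mulr_gt0.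
have sp0 : 0 < Num.sqrt pi :> R by rewrite sqrtr_gt0.
have s20 : 0 < Num.sqrt 2 :> R by rewrite sqrtr_gt0.
have -> : pi `^ (k.+2%:R / 2) = Num.sqrt pi ^+ k.+2 :> R.
  by rewrite mulrC powRrM powR12_sqrt ?ltW// powR_mulrn// sqrtr_ge0.
have -> : expR ((1 - k.+2%:R) * stirling_const - k.+2%:R / 12) =
    Num.sqrt (2 * pi) / Num.sqrt (2 * pi) ^+ k.+2 * expR (- (k.+2%:R / 12)) :> R.
  by rewrite expRD mulrBl mul1r expRB expRM_natl ln_2pi_half.
rewrite GammaR_gauss /shtarkov_const.
have -> : Num.sqrt (2 * pi) = Num.sqrt 2 * Num.sqrt pi :> R by rewrite sqrtrM.
rewrite exprMn.
have g0 := gauss_val_gt0 (R := R) k.+1.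
have := exprn_gt0 k.+2 sp0; have := exprn_gt0 k.+2 s20.
move: (gauss_val k.+1) g0 (Num.sqrt pi ^+ k.+2) (Num.sqrt 2 ^+ k.+2) => g g0 a b b0 a0.
move: (expR _) (k.+3%:R : R) (ltr0n R k.+3) => e c /= c0.
by field; rewrite !gt_eqF.
Qed.

Theorem theorem4p1 (R : realType) (m p q : nat)
    (AE : 'M[R]_(p, m)) (AI : 'M[R]_(q, m)) (bE : 'cV[R]_p) (bI : 'cV[R]_q)
    (betaE : 'cV[R]_p) (betaI : 'cV[R]_q)
    (xs : 'cV[R]_m) (s1 s2 delta eta : R) (nus : 'cV[nat]_m)
    (C0 := feasible AE AI bE bI)
    (Cdelta := tolerant AE AI bE bI betaE betaI delta)
    (ss := vsum xs) (chis := ss^-1 *: xs) (Gs := entropy xs)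
    (n1 := Num.ceil s1) (n2 := Num.ceil s2) (ns := Num.ceil ss)
    (hm : (2 <= m)%N)
    (hC0 : C0 !=set0) (hbnd : bounded_set C0)
    (hbetaE : zeros_replaced bE betaE) (hbetaI : zeros_replaced bI betaI)
    (hxs : C0 xs) (hmax : forall x, C0 x -> entropy x <= Gs)
    (hs1 : is_min [set vsum x | x in C0] s1)
    (hs2 : is_max [set vsum x | x in C0] s2)
    (hxs1 : forall i, 1 < xs i ord0)
    (hdelta : 0 < delta) (heta : 0 < eta)
    (hnus : is_optimal_count ns chis nus) :
  (((m.+1%:R * expR (- (m%:R / 12)) * GammaR (m%:R / 2)
      / (2 * pi `^ (m%:R / 2)))
     * (C2 xs * C4 xs / C3 m s1 s2) * expR (eta * Gs))%:E
   < (nb_real nus)%:R%:E / nb_real_set R (low_entropy Cdelta n1 n2 Gs eta))%E.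
Proof.
have x0 i : 0 < xs i ord0 by exact: lt_trans ltr01 (hxs1 i).
have ss0 : 0 < ss.
  have i0 := Ordinal hm.
  rewrite /ss /vsum (bigD1 i0)//= ltr_pwDl// sumr_ge0// => i _; exact: ltW.
have nat_ceil (y : R) : 0 <= y -> exists2 N : nat, Num.ceil y = N%:Z & y <= N%:R < y + 1.
  move=> y0; have c0 : 0 <= Num.ceil y by rewrite ceil_ge0 (lt_le_trans (ltrN10 R)).
  exists `|Num.ceil y|%N; first by rewrite gez0_abs.
  have -> : `|Num.ceil y|%N%:R = (Num.ceil y)%:~R :> R by rewrite -[in RHS](gez0_abs c0).
  by have /andP[h1 h2] := ceil_itv y; rewrite h2/=; move: h1; rewrite intrB; lra.
have s10 : 0 <= s1.
  have [[y [_ _ y0] <-] _] := hs1.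
  by apply: sumr_ge0 => i _; have := y0 i; rewrite mxE.
have s12 : s1 <= s2.
  by have [hs _] := hs2; have [_] := hs1; apply.
have [N1 n1E /andP[sN1 _]] := nat_ceil s1 s10.
have [N2 n2E /andP[_ sN2]] := nat_ceil s2 (le_trans s10 s12).
have [N nE /andP[sN Ns]] := nat_ceil ss (ltW ss0).
have N12 : (N1 <= N2)%N by rewrite -lez_nat -n1E -n2E le_ceil.
have [cN nuB] := optimal_countP _ _ _ _ hnus.
have {}cN : csum nus = N by move: cN; rewrite /ns nE => -[].
have nb_ge := nb_real_ge _ xs nus hm hxs1.
rewrite cN in nb_ge; have {}nb_ge := nb_ge _ _.
have {}nb_ge : expR ((1 - m%:R) * stirling_const - m%:R / 12) * (C2 xs * C4 xs) *
    expR Gs <= (nb_real nus)%:R.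
  apply: nb_ge; first by rewrite sN ltW.
  move=> i; have := nuB i; rewrite /ns nE /chis mxE.
  by rewrite [_^-1 * _]mulrC.
have HB nu : low_entropy Cdelta n1 n2 Gs eta nu ->
    (N1 <= csum nu <= N2)%N /\ entropy (realv R nu) <= (1 - eta) * Gs.
  by rewrite /n1 /n2 n1E n2E => -[_ h /ltW].
have [S SE /andP[S0 Sle]] := nb_real_set_le _ _ N1 N2 _ HB.
rewrite SE; have nb0 := nb_real_gt0 (R := R) m nus.
(* A zero denominator makes the ratio +oo, above any real. *)
have [S00|Sn0] := eqVneq S 0.
  by rewrite S00 inver eqxx gt0_muley ?lte_fin// ltry.
have Spos : 0 < S by rewrite lt_def Sn0.
rewrite inver (negbTE Sn0) -EFinM lte_fin ltr_pdivlMr//.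
have Hsum : \sum_(N1 <= n < N2.+1) shtarkov N2.+1 m n <
    shtarkov_const m.-1 * (2 / m.+1%:R) * C3 m s1 s2.
  case: (m) hm => // j _; apply: shtarkov_sum_lt => //.
  by rewrite (leq_trans N12).
have K0 : 0 < shtarkov_const m.-1 * (2 / m.+1%:R) :> R.
  by apply: mulr_gt0; [exact: shtarkov_const_gt0|exact: divr_gt0].
(* A positive S forces the Shtarkov sum, and with it C3, to be positive, as the division by C3
   requires. *)
have sum0 : 0 < \sum_(N1 <= n < N2.+1) shtarkov N2.+1 m n :> R.
  by have := lt_le_trans Spos Sle; rewrite (pmulr_rgt0 _ (expR_gt0 _)).
have C30 : 0 < C3 m s1 s2 by move: (lt_trans sum0 Hsum); rewrite (pmulr_rgt0 _ K0).
have C240 : 0 < C2 xs * C4 xs by rewrite C2_ln// /C4 mulr_gt0 ?expR_gt0.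
apply: lt_le_trans nb_ge; rewrite -(gamma_prefactorE _ _ hm).
set P := _ / (2 * pi `^ _).
have P0 : 0 < P.
  have := expR_gt0 ((1 - m%:R) * stirling_const - m%:R / 12 : R).
  by rewrite -(gamma_prefactorE _ _ hm) -/P (pmulr_lgt0 _ K0).
set K := shtarkov_const _ * _ in K0 Hsum *.
have {}Sle : S < expR ((1 - eta) * Gs) * (K * C3 m s1 s2).
  by apply: le_lt_trans Sle _; rewrite ltr_pM2l ?expR_gt0.
have L0 : 0 < P * (C2 xs * C4 xs / C3 m s1 s2) * expR (eta * Gs).
  by rewrite mulr_gt0 ?expR_gt0// mulr_gt0// divr_gt0.
(* Multiplied by the claimed bound on the ratio, the bound on S becomes exactly the lower bound on
   the numerator. *)
rewrite -(ltr_pM2l L0) in Sle; apply: lt_le_trans Sle _; apply: eq_ler.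
have -> : expR Gs = expR (eta * Gs) * expR ((1 - eta) * Gs).
  by rewrite -expRD; congr expR; ring.
move: (C3 m s1 s2) C30 => c c0.
by field; rewrite gt_eqF.
Qed.
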